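(* Let $p$ be a prime, $G$ a finite group, $\mathfrak{F}$ a solubly saturated formation containing the class $\mathfrak{U}$ of all finite supersolvable groups, and $E$ a normal subgroup of $G$ with $G/E\in\mathfrak{F}$. Suppose that for any Sylow $p$-subgroup $P$ of $F_p^*(E)$, every cyclic subgroup of $P$ of prime order or of order $4$ (the latter only when $P$ is not quaternion-free) satisfies partial $\Pi$-property in $G$. Then $G\in\mathfrak{G}_{p'}\mathfrak{F}$.
   Context: All groups are finite. For a positive integer $n$ and a set of primes $\pi$, $n$ is a $\pi$-number if all its prime divisors lie in $\pi$ (so $1$ is a $\pi$-number for every $\pi$, including $\pi=\emptyset$); $\pi(H)$ is the set of prime divisors of $|H|$. Partial $\Pi$-property: a subgroup $H$ of $G$ satisfies partial $\Pi$-property in $G$ if there exists a chief series $1=G_0<G_1<\cdots<G_n=G$ of $G$ such that for every $1\leq i\leq n$, the index $|G/G_{i-1}:N_{G/G_{i-1}}(HG_{i-1}/G_{i-1}\cap G_i/G_{i-1})|$ is a $\pi(HG_{i-1}/G_{i-1}\cap G_i/G_{i-1})$-number. A group is quaternion-free if it has no section isomorphic to the quaternion group of order $8$; thus the condition on cyclic subgroups of order $4$ is imposed only when $p=2$ and $P$ is not quaternion-free. A formation is a class of groups closed under homomorphic images and subdirect products. A formation $\mathfrak{F}$ is solubly saturated if $G\in\mathfrak{F}$ whenever $G/\Phi(N)\in\mathfrak{F}$ for some solvable normal subgroup $N$ of $G$. $\mathfrak{G}_{p'}$ is the class of all finite $p'$-groups, and $\mathfrak{G}_{p'}\mathfrak{F}$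 is the class of groups $G$ having a normal $p'$-subgroup $N$ with $G/N\in\mathfrak{F}$. A group is $p$-quasinilpotent if it induces inner automorphisms on each of its chief factors of order divisible by $p$. The $p$-generalized Fitting subgroup $F_p^*(E)$ is the $p$-quasinilpotent radical of $E$, i.e. its largest normal $p$-quasinilpotent subgroup. *)

(* Defs.v *)
From HB Require Import structures.
From mathcomp Require Import all_boot all_fingroup all_solvable.
Set Implicit Arguments.
Unset Strict Implicit.
Unset Printing Implicit Defensive.

Import GroupScope.

(* Classes of finite groups. Invariance under isomorphism is not built in; for
   formations it follows from closure under homomorphic images. *)
Definition group_class := forall gT : finGroupType, {group gT} -> Prop.

Definition subclass (X Y : group_class) : Prop :=
  forall (gT : finGroupType) (G : {group gT}), X gT G -> Y gT G.

Definition closed_morphim (F : group_class) : Prop :=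
  forall (aT rT : finGroupType) (G : {group aT}) (f : {morphism G >-> rT}),
    F aT G -> F rT (f @* G)%G.

(* A subdirect product of A and B is a subgroup of A x B that projects onto
   both factors. *)
Definition closed_subdirect (F : group_class) : Prop :=
  forall (aT bT : finGroupType) (A : {group aT}) (B : {group bT})
         (H : {group aT * bT}),
    [set x.1 | x in H] = A -> [set x.2 | x in H] = B ->
    F aT A -> F bT B -> F (aT * bT)%type H.

Definition formation (F : group_class) : Prop :=
  closed_morphim F /\ closed_subdirect F.

Definition solubly_saturated (F : group_class) : Prop :=
  forall (gT : finGroupType) (G N : {group gT}),
    N <| G -> solvable N -> F (coset_of 'Phi(N)) (G / 'Phi(N))%G -> F gT G.

(* Existence of a series 1 = G_0 <= ... <= G_n = G with every G_i normal in G
   and every G_i / G_(i-1) cyclic. *)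
Definition supersolvable : group_class := fun gT G =>
  exists2 s : seq {group gT},
    path (fun V U : {group gT} => [&& V \subset U, U <| G & cyclic (U / V)])
         1%G s
    & last 1%G s = G.

Definition p'_by (p : nat) (F : group_class) : group_class := fun gT G =>
  exists N : {group gT}, [/\ N <| G, p^'.-group N & F (coset_of N) (G / N)%G].

Section OneGroup.

Variable gT : finGroupType.
Implicit Types A B E G H K L P U V : {group gT}.

(* For consecutive terms K < L of the series, H * K / K :&: L / K is
   HK/K \cap L/K; the i-th factor (0 <= i < n) has K = G_i and L = G_(i+1). *)
Definition partial_Pi G H : Prop :=
  exists s : seq {group gT},
    [/\ (G.-chief).-series 1%G s, last 1%G s = G
      & forall i, i < size s ->
          let K := nth 1%G (1%G :: s) i in
          let L := nth 1%G s i in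
          let X := (H * K) / K :&: L / K in
          \pi(X).-nat #|G / K : 'N_(G / K)(X)| ].

Definition quaternion_free P : bool :=
  [forall A : {group gT}, forall B : {group gT},
    (A \subset P) && (B <| A) ==> ~~ (A / B \isog 'Q_8)].

(* Each element of A acts by conjugation on U / V as some element of U / V. *)
Definition induces_inner A U V : bool :=
  [forall a in A, exists z in U / V,
     forall y in U / V, y ^ coset V a == y ^ z].

Definition pquasinilpotent (p : nat) A : bool :=
  [forall U : {group gT}, forall V : {group gT},
    chief_factor A V U && (p %| #|U / V|) ==> induces_inner A U V].

(* The p-quasinilpotent radical F_p^*(E). Products of normal p-quasinilpotent
   subgroups are p-quasinilpotent, so the subgroup they all generate is the
   largest of them. *)
Definition gen_pFitting (p : nat) E : {group gT} :=
  <<\bigcup_(N : {group gT} | (N <| E) && pquasinilpotent p N) N>>%G.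

End OneGroup.

(* Main.v *)
(* Modulo N = O_p'(E), the p'-elements of X = F_p^*(E) centralise every normal
   p-subgroup of E. If X were not a p-group, a minimal G-normal subgroup R of X
   that is not a p-group would have its elements of order p (and 4) in the
   central subgroup O_p(R) by the partial Pi-property, hence be p-nilpotent by
   Frobenius' criterion, and then trivial. So X is a p-group. Let D be the
   smallest normal subgroup of G with G/D abelian of exponent dividing p - 1.
   The partial Pi-property also shows that p'-elements of D centralise X; since
   C_E(X) <= X, the group E :&: D is a p-group, and every chief factor of G below
   E has prime order.

   It remains to climb from F(G/L) to F(G) for a normal subgroup L of prime order
   q. Let C be cyclic of order q^2 with G acting on C through the lift of its
   action on L. In C ><| G the subgroups L and Phi(C) are G-isomorphic; dividing
   by their diagonal identifies L with the Frattini subgroup of C, so solubly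
   saturated formations contain that quotient, and C ><| G, and then G. *)

Require Import Defs.
From mathcomp Require Import all_boot all_order all_algebra all_fingroup all_solvable.
From mathcomp Require Import all_field mxrepresentation mxabelem.

Set Implicit Arguments.
Unset Strict Implicit.
Unset Printing Implicit Defensive.

Import GroupScope.

(** The chief series supplied by the partial Pi-property depends on the subgroup [H], so two normal
    subgroups [V < R] of [G] chosen by a minimality argument need not be terms of it. What survives
    is a statement about the index of the normalizer of [H <*> V]: it is a power of [p], so this
    normalizer and a Sylow [p]-subgroup [S] together give all of [G]. Every use of the property
    exploits this factorization. The residual [D] appears because [G] can act on a chief factor of
    order [p] as any subgroup of a cyclic group of order [p - 1]; only [D] can be expected to act
    trivially. For [p = 2] it is all of [G]. Saturation only speaks of Frattini subgroups of
    solvable normal subgroups, while a normal subgroup of prime order may well be complemented. This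
    is why it must first be matched with a Frattini subgroup inside a larger group, and [q ^ 2] is
    the least order of a cyclic [q]-group whose Frattini subgroup has order [q]. *)

(** * Elements of order prime to [p] acting on [p]-groups *)

(** When [a] commutes with [[~ x, a]], the power [[~ x, a] ^+ n] is [[~ x, a ^+ n]], so the order of
    the commutator divides that of [a]. *)
Lemma coprime_commute_comm_eq1 (gT : finGroupType) (x a : gT) :
  commute a [~ x, a] -> coprime #[[~ x, a]] #[a] -> [~ x, a] = 1.
Proof.
move=> caw co; apply/eqP; rewrite -order_eq1 -dvdn1 -(eqnP co) dvdn_gcd dvdnn.
by rewrite order_dvdn -commgX // expg_order commg1 eqxx.
Qed.

Lemma p_p'elt_coprime_order (gT : finGroupType) (p : nat) (w a : gT) :
  p.-elt w -> p^'.-elt a -> coprime #[w] #[a].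
Proof. exact: pnat_coprime. Qed.

Lemma commute_comm_eq1 (gT : finGroupType) (p : nat) (x a : gT) :
  p.-elt [~ x, a] -> p^'.-elt a -> commute a [~ x, a] -> [~ x, a] = 1.
Proof.
move=> pw p'a cwa; apply: coprime_commute_comm_eq1 => //.
exact: p_p'elt_coprime_order pw p'a.
Qed.

Lemma comm_mem_norm (gT : finGroupType) (Q : {group gT}) (x a : gT) :
  x \in Q -> a \in 'N(Q) -> [~ x, a] \in Q.
Proof. by move=> Qx nQa; rewrite commgEl groupM ?groupV ?memJ_norm. Qed.

Lemma quaternion_freeS (gT : finGroupType) (P Q : {group gT}) :
  Q \subset P -> quaternion_free P -> quaternion_free Q.
Proof.
move=> sQP /forallP qfP; apply/forallP=> A; apply/forallP=> B.
apply/implyP=> /andP[sAQ nsBA]; move: (qfP A) => /forallP/(_ B)/implyP; apply.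
by rewrite (subset_trans sAQ sQP).
Qed.

(** The presentation makes [G] an image of the quaternion group, so its order divides 8; a smaller
    order would make [G] abelian. *)
Lemma Q8_isog_of_relations (gT : finGroupType) (G : {group gT}) (x y : gT) :
  <[x]> <*> <[y]> = G -> y ^+ 2 = x ^+ 2 -> x ^ y = x^-1 -> x ^+ 4 = 1 ->
  ~ commute x y -> G \isog 'Q_8.
Proof.
move=> defG y2 xy x4 ncxy.
have homG: G \homg Grp (x : y : x ^+ 4, y ^+ 2 = x ^+ 2, x ^ y = x^-1).
  by apply/existsP; exists (x, y); rewrite /= !xpair_eqE defG x4 y2 xy !eqxx.
apply/(isoGrpP G (@Grp_quaternion 3 isT)); split; last exact: homG.
rewrite (@card_quaternion 3) //.
have dvG: #|G| %| 8.
  have: G \homg [set: 'Q_(2 ^ 3)] by rewrite (Grp_quaternion (n := 3)).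
  by move/card_homg; rewrite (@card_quaternion 3).
have [pG oG]: 2.-group G /\ exists2 k, k <= 3 & #|G| = (2 ^ k)%N.
  have/(dvdn_pfactor _ 3 (isT : prime 2))[k le_k oG] := dvG.
  by split; [rewrite /pgroup oG pnatX | exists k].
case: oG => k le_k oG; rewrite oG; congr (2 ^ _)%N; apply/eqP.
rewrite eqn_leq le_k ltnNge; apply/negP=> k2; case: ncxy.
have abG: abelian G by apply: (p2group_abelian pG); rewrite oG pfactorK.
by apply/(centsP abG); rewrite -defG mem_gen // inE cycle_id ?orbT.
Qed.

(* [w] and [v] generate a quaternion group modulo the central involution
   [w ^+ 2 * [~ w, v]], which is trivial if they already generate one. *)
Lemma Q8_section (gT : finGroupType) (P : {group gT}) (w v : gT) :
  w \in P -> v \in P -> v ^+ 2 = w ^+ 2 -> w ^+ 4 = 1 -> w ^+ 2 != 1 ->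
  commute w [~ w, v] -> commute v [~ w, v] ->
  [~ w, v] ^+ 2 = 1 -> [~ w, v] != 1 -> ~~ quaternion_free P.
Proof.
set c := [~ w, v] => Pw Pv v2 w4 b1 cwc cvc c2 c1.
pose A := <<[set w; v]>>%G; pose d := w ^+ 2 * c; pose B := <[d]>%G.
have Aw: w \in A by rewrite mem_gen // !inE eqxx.
have Av: v \in A by rewrite mem_gen // !inE eqxx orbT.
have Ac: c \in A by rewrite groupR.
have cwb: commute w (w ^+ 2) by apply: commuteX.
have cvb: commute v (w ^+ 2) by rewrite -v2; apply: commuteX.
have cAd: A \subset 'C[d].
  rewrite gen_subG; apply/subsetP=> z /set2P[]->; rewrite cent1C; apply/cent1P.
    exact/commute_sym/commuteM.
  exact/commute_sym/commuteM.
have cbc: commute (w ^+ 2) c by apply/commute_sym/commuteX/commute_sym.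
have d2: d ^+ 2 = 1 by rewrite expgMn // -expgM w4 c2 mulg1.
have Ad: d \in A by rewrite groupM ?groupX.
have nsBA: B <| A.
  by rewrite /normal cycle_subG Ad cents_norm // cent_cycle.
have sAP: A \subset P by rewrite gen_subG; apply/subsetP=> z /set2P[]->.
have Bdef z: z \in B -> z = 1 \/ z = d.
  case/cycleP=> i ->; rewrite -(odd_double_half i) expgD -mul2n expgM d2 expg1n.
  by rewrite mulg1; case: (odd i); [right | left].
have nBB z: z \in A -> z \in 'N(B) by apply/subsetP/normal_norm.
rewrite /quaternion_free; apply/forallPn; exists A.
rewrite negb_forall; apply/existsP; exists B.
rewrite negb_imply sAP nsBA /= negbK.
have cd: coset B d = 1 by apply: coset_id; apply: cycle_id.
have cce: coset B c = coset B (w ^+ 2).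
  apply/esym/eqP; rewrite eq_mulgV1 -morphV ?nBB //= -morphM ?nBB ?groupV ?groupX //=.
  have ->: c^-1 = c by apply/eqP; rewrite eq_invg_mul -(expgS c 1) c2.
  by apply/eqP; rewrite -/d cd.
have cor2: coset B w ^+ 4 = 1 by rewrite -morphX ?nBB //= w4 morph1.
apply: (@Q8_isog_of_relations _ _ (coset B w) (coset B v)) => //.
- rewrite /= quotient_gen ?subUset ?sub1set ?nBB //.
  by rewrite quotientU !quotient_set1 ?nBB // joing_idl joing_idr.
- by rewrite -!morphX ?nBB // v2.
- rewrite conjg_mulR -morphR ?nBB //= -/c cce morphX ?nBB //.
  apply/eqP; rewrite eq_sym eq_invg_mul.
  by rewrite -!expgS cor2 eqxx.
move=> cxy; have: coset B c = 1.
  rewrite /c morphR ?nBB //=; apply/eqP/commgP/commute_sym; exact: commute_sym.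
move/(coset_idr (nBB _ Ac))/Bdef=> [] ec; first by rewrite ec eqxx in c1.
by move: b1; rewrite -(inj_eq (mulIg c)) mul1g -/d -ec eqxx.
Qed.

(** Coprime action on an abelian group: [[~: A, <[a]>]] contains no nontrivial fixed point of [a],
    yet if nontrivial it would contain an element of order [p]. *)
Lemma p'elt_cent_abelian (gT : finGroupType) (p : nat) (A : {group gT}) a :
  p.-group A -> abelian A -> a \in 'N(A) -> p^'.-elt a ->
  (forall x, x \in A -> #[x] = p -> [~ x, a] = 1) -> a \in 'C(A).
Proof.
move=> pA abA nAa p'a cA.
have nAA: <[a]> \subset 'N(A) by rewrite cycle_subG.
have coA: coprime #|A| #|<[a]>| by apply: (pnat_coprime (pi := p)).
have tiA := coprime_abel_cent_TI nAA coA abA.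
rewrite -cycle_subG centsC; apply/commG1P; apply/eqP/negPn/negP=> ntR.
have sRA: [~: A, <[a]>] \subset A by rewrite commg_subl.
have pR: p.-group [~: A, <[a]>] := pgroupS sRA pA.
have [p_pr p_dv _] := pgroup_pdiv pR ntR.
have [x Rx ox] := Cauchy p_pr p_dv.
have: x \in [1 gT].
  rewrite -tiA inE Rx cent_cycle; apply/cent1P/commgP/eqP.
  exact: cA _ (subsetP sRA _ Rx) ox.
by move/set1P=> x1; move: ox p_pr; rewrite x1 order1 => <-.
Qed.

(** By the three subgroups lemma [[~: Q, <[a]>]] centralises [K], hence lies in ['Z(K)], which [a]
    centralises; then [a] commutes with its own commutators. *)
Lemma cent_critical_p'elt (gT : finGroupType) (p : nat) (Q K : {group gT}) a :
  p.-group Q -> critical K Q -> a \in 'N(Q) -> p^'.-elt a -> a \in 'C(K) ->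
  a \in 'C(Q).
Proof.
move=> pQ [chK _ sRZ defZ] nQa p'a cKa; have sKQ := char_sub chK.
have caK: <[a]> \subset 'C(K) by rewrite cycle_subG.
have sC: [~: Q, <[a]>] \subset 'C(K).
  apply/commG1P/three_subgroup; first by rewrite (commG1P caK) comm1G.
  apply/commG1P; rewrite commGC in sRZ.
  by rewrite (subset_trans sRZ) // (subset_trans (center_sub K)) // centsC.
apply/centP=> x Qx; apply/commute_sym/commgP/eqP.
have Qw: [~ x, a] \in Q by apply: comm_mem_norm.
apply: (@commute_comm_eq1 _ p) => //; first exact: mem_p_elt pQ Qw.
apply: (centP cKa); apply: (subsetP (center_sub K)); rewrite -defZ inE Qw.
by apply: (subsetP sC); rewrite mem_commg ?cycle_id.
Qed.

(** It suffices to treat a critical subgroup [K], of class at most 2 and with [p]-th powers in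
    ['Z(K)]. As [a] fixes ['Z(K)], the elements [x] and [x ^ a] have the same [p]-th power, so
    [[~ x, a] ^+ p] is a commutator raised to ['C(p, 2)], hence trivial for odd [p]. For [p = 2]
    only [[~ x, a] ^+ 4 = 1] follows, and order 4 is where quaternion sections enter. *)
Lemma p'elt_cent_pgroup (gT : finGroupType) (p : nat) (Q : {group gT}) a :
  p.-group Q -> a \in 'N(Q) -> p^'.-elt a ->
  (forall x, x \in Q -> #[x] = p -> [~ x, a] = 1) ->
  (p = 2 -> quaternion_free Q \/
     forall x, x \in Q -> #[x] = 4 -> [~ x, a] = 1) ->
  a \in 'C(Q).
Proof.
move=> pQ nQa p'a cQp cQ4.
have [-> | ntQ] := eqVneq Q 1%G; first by rewrite cent1T inE.
have [p_pr _ _] := pgroup_pdiv pQ ntQ.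
have cw1 x: x \in Q -> [~ [~ x, a], a] = 1 -> [~ x, a] = 1.
  move=> Qx /eqP/commgP cw; apply: (@commute_comm_eq1 _ p) => //.
  by apply: (mem_p_elt pQ); apply: comm_mem_norm.
have cwp x: x \in Q -> [~ x, a] ^+ p = 1 -> [~ x, a] = 1.
  move=> Qx wp; apply: (cw1 _ Qx).
  have: #[[~ x, a]] %| p by rewrite order_dvdn wp.
  case/(primeP p_pr).2/orP=> /eqP ow; last exact/cQp/ow/comm_mem_norm.
  by move/eqP: ow; rewrite order_eq1 => /eqP->; rewrite comm1g.
have [K critK] := Thompson_critical pQ; have [chK sPhiZ _ _] := critK.
have sKQ := char_sub chK; have pK := pgroupS sKQ pQ.
have nKa: a \in 'N(K).
  by rewrite -cycle_subG (char_norm_trans chK) ?cycle_subG.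
have nZa: a \in 'N('Z(K)) 
  by rewrite -cycle_subG (char_norm_trans (center_char K)) ?cycle_subG.
have cZa z: z \in 'Z(K) -> [~ z, a] = 1.
  suff /centP cZ: a \in 'C('Z(K)) by move/cZ=> caz; apply/eqP/commgP.
  apply: (@p'elt_cent_abelian _ p 'Z(K)%G) => //; last first.
  - by move=> x /setIP[Kx _]; apply: cQp; apply: (subsetP sKQ).
  - exact: center_abelian.
  exact: pgroupS (center_sub K) pK.
have Zp x: x \in K -> x ^+ p \in 'Z(K).
  move=> Kx; apply: (subsetP sPhiZ); rewrite (Phi_joing pK).
  by apply: mem_gen; rewrite inE -{2}(expn1 p) Mho_p_elt ?orbT ?(mem_p_elt pK).
have ZR x y: x \in K -> y \in K -> [~ x, y] \in 'Z(K).
  move=> Kx Ky; apply: (subsetP sPhiZ); rewrite (Phi_joing pK).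
  by apply: mem_gen; rewrite inE mem_commg.
have Zcom z x: z \in 'Z(K) -> x \in K -> commute z x.
  by case/setIP=> _ /centP cz /cz.
have Ka x: x \in K -> x ^ a \in K by move=> Kx; rewrite memJ_norm.
have Zpa x: x \in K -> (x ^ a) ^+ p = x ^+ p.
  by move=> Kx; rewrite -conjXg conjg_mulR cZa ?mulg1 ?Zp.
(* The class 2 power formula applied to [[~ x, a] = x^-1 * x ^ a]. *)
have pow x: x \in K -> [~ x, a] ^+ p = [~ x ^ a, x^-1] ^+ 'C(p, 2).
  move=> Kx; have Kxa := Ka _ Kx; have Kx' := groupVr Kx.
  have Zc := ZR _ _ Kxa Kx'; rewrite commgEl expMg_Rmul.
  - by rewrite Zpa // expgVn mulVg mul1g.
  - exact/commute_sym/Zcom.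
  exact/commute_sym/Zcom.
have cp x: x \in K -> [~ x ^ a, x^-1] ^+ p = 1.
  move=> Kx; have Kxa := Ka _ Kx; have Kx' := groupVr Kx.
  rewrite -commXg; last exact/commute_sym/Zcom/Kxa/ZR.
  by apply/eqP/commgP/Zcom => //; apply: Zp.
have cK x: x \in K -> [~ x, a] = 1.
  move=> Kx; have Qx := subsetP sKQ _ Kx.
  have [p2 | p_odd] := eqVneq p 2; last first.
    apply: (cwp _ Qx); rewrite pow //.
    have /dvdnP[k ->]: p %| 'C(p, 2).
      by rewrite prime_dvd_bin //= ltn_neqAle eq_sym p_odd prime_gt1.
    by rewrite mulnC expgM cp // expg1n.
  subst p; have pow2 y : y \in K -> [~ y, a] ^+ 2 = [~ y ^ a, y^-1].
    by move=> Ky; rewrite pow.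
  set w := [~ x, a]; have Kw: w \in K by apply: comm_mem_norm.
  have Qw := subsetP sKQ _ Kw.
  have w4: w ^+ 4 = 1 by rewrite (expgM w 2 2) pow2 // cp.
  have [w2 | nw2] := eqVneq (w ^+ 2) 1; first exact: cwp.
  have ow: #[w] = 4.
    have: #[w] %| 4 by rewrite order_dvdn w4.
    have: ~~ (#[w] %| 2) by rewrite order_dvdn.
    move=> n2 d4; have := dvdn_leq (isT : 0 < 4) d4.
    by move: n2 d4; case: (#[w]) => [|[|[|[|[|]]]]].
  case: (cQ4 (erefl _)) => [qfQ | c4]; last exact/cw1/c4.
  (* The equal squares of [w] and [w ^ a] give a quaternion section unless these two elements
     commute; by [pow2], they fail to commute exactly when [[~ w, a] ^+ 2] is nontrivial. *)
  have [w12 | nw12] := eqVneq ([~ w, a] ^+ 2) 1; first exact/cw1/cwp.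
  have Kwa := Ka _ Kw; have Zwv := ZR _ _ Kw Kwa.
  have cwv: [~ w, w ^ a] ^+ 2 = 1.
    rewrite -commXg; last exact/commute_sym/Zcom.
    by apply/eqP/commgP/Zcom => //; apply: Zp.
  suff /negP[]: ~~ quaternion_free Q by [].
  have Qwa := subsetP sKQ _ Kwa.
  apply: (Q8_section Qw Qwa (Zpa _ Kw) w4 nw2 _ _ cwv).
  - exact/commute_sym/Zcom.
  - exact/commute_sym/Zcom.
  rewrite pow2 // in nw12; apply: contra nw12 => /commgP cwa.
  by apply/commgP/commuteV/commute_sym.
apply: (cent_critical_p'elt pQ critK) => //.
by apply/centP=> x Kx; apply/commute_sym/commgP/eqP/cK.
Qed.

(** * Fusion and transfer: a form of Frobenius' criterion *)

Lemma coprime_expg_eq1 (gT : finGroupType) (x : gT) m n :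
  coprime m n -> x ^+ m = 1 -> x ^+ n = 1 -> x = 1.
Proof.
move=> /eqnP co xm xn; apply/eqP; rewrite -order_eq1 -dvdn1 -co dvdn_gcd.
by rewrite !order_dvdn xm xn eqxx.
Qed.

Lemma pgroup_quotient_p'elt (gT : finGroupType) (p : nat) (G K : {group gT}) :
  G \subset 'N(K) -> (forall x, x \in G -> p^'.-elt x -> x \in K) -> p.-group (G / K).
Proof.
move=> nKG p'K; apply/pgroupP=> q pr_q /(Cauchy pr_q)[y Gy oy].
case/morphimP: Gy oy => x nKx Gx -> oy.
have: coset K x.`_p^' = 1.
  by apply: coset_id; apply: p'K; [rewrite groupX | rewrite p_elt_constt].
rewrite morph_constt // => /constt1P; rewrite /p_elt oy pnatNK pnatE //.
Qed.

Lemma pgroup_of_p'elt_eq1 (gT : finGroupType) (p : nat) (G : {group gT}) :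
  (forall x, x \in G -> p^'.-elt x -> x = 1) -> p.-group G.
Proof.
move=> p'1; rewrite (isog_pgroup _ (quotient1_isog G)).
by apply: pgroup_quotient_p'elt (norms1 G) _ => x Gx /(p'1 x Gx) ->.
Qed.

Section NormalizerFusion.

Import FiniteModule.

Variables (gT : finGroupType) (p : nat) (R : {group gT}).

Hypothesis cent_p'elt : forall (Q : {group gT}) a, p.-group Q -> Q \subset R ->
  a \in 'N_R(Q) -> p^'.-elt a -> a \in 'C(Q).

(** All [p']-elements of ['N_R(D)] lie in ['C_R(D)], so the quotient is a [p]-group and is covered
    by [S]. *)
Lemma norm_eq_mul_cent (D S : {group gT}) :
  p.-group D -> D \subset R -> p.-Sylow('N_R(D)) S ->
  'N_R(D) = S * 'C_R(D).
Proof.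
move=> pD sDR sylS; have nC: 'N_R(D) \subset 'N('C_R(D)).
  by rewrite normsI ?norms_cent ?subsetIr // (subset_trans (subsetIl _ _)) ?normG.
have nsC: 'C_R(D) <| 'N_R(D) by rewrite /normal nC setIS ?cent_sub.
have pq: p.-group ('N_R(D) / 'C_R(D)).
  apply: pgroup_quotient_p'elt => // x Nx p'x; rewrite inE (cent_p'elt pD) //.
  by case/setIP: Nx => ->.
rewrite (normC (subset_trans (pHall_sub sylS) nC)).
apply/eqP; rewrite eqEsubset mulG_subG (normal_sub nsC) (pHall_sub sylS) !andbT.
rewrite -quotientSK //.
have := quotient_pHall (subset_trans (pHall_sub sylS) nC) sylS.
by move/(pHall_id)/(_ pq)=> <-.
Qed.

(* Alperin's argument: passing to Sylow subgroups of the normalizer of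
   [S :&: T] enlarges the intersection, and there fusion is central. *)
Lemma Sylow_conj_cent (S T : {group gT}) : p.-Sylow(R) S -> p.-Sylow(R) T ->
  exists2 c, c \in 'C_R(S :&: T) & S :^ c = T.
Proof.
have [m] := ubnP (#|R| - #|S :&: T|); elim: m S T => // m IHm S T.
set D := (S :&: T)%G; rewrite ltnS => le_m sylS sylT.
have [sSR pS _] := and3P sylS; have [sTR pT _] := and3P sylT.
have sDS: D \subset S := subsetIl _ _; have sDT: D \subset T := subsetIr _ _.
have oST: #|S| = #|T| by rewrite (card_Hall sylS) (card_Hall sylT).
have [eDS | neDS] := eqVneq D S.
  exists 1; first exact: group1.
  by rewrite conjsg1; apply/eqP; rewrite eqEcard oST leqnn andbT -{1}eDS.
have ltDS: D \proper S by rewrite properEneq sDS andbT.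
have ltDT: D \proper T.
  rewrite properEcard sDT -oST; exact: proper_card.
have pD := pgroupS sDS pS; have sDR := subset_trans sDS sSR.
have ltNS := nilpotent_proper_norm (pgroup_nil pS) ltDS.
have ltNT := nilpotent_proper_norm (pgroup_nil pT) ltDT.
have [S1 sylS1 sNS1] := Sylow_superset (setSI 'N(D) sSR) (pgroupS (subsetIl _ _) pS).
have [T1 sylT1 sNT1] := Sylow_superset (setSI 'N(D) sTR) (pgroupS (subsetIl _ _) pT).
have [n Nn defT1] := Sylow_trans sylS1 sylT1.
have [c1 Cc1 defT1']: exists2 c1, c1 \in 'C_R(D) & T1 :=: S1 :^ c1.
  have: n \in S1 * 'C_R(D) by rewrite -(norm_eq_mul_cent pD sDR sylS1).
  case/mulsgP=> s c Ss Cc en.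
  by exists c => //; rewrite defT1 en conjsgM conjGid.
have sNR: 'N_R(D) \subset R := subsetIl _ _.
have [S2 sylS2 sS12] := Sylow_superset (subset_trans (pHall_sub sylS1) sNR)
  (pHall_pgroup sylS1).
have Rc1: c1 \in R by case/setIP: Cc1.
have sylT2: p.-Sylow(R) (S2 :^ c1)%G by rewrite pHallJ.
have grow (U V W : {group gT}) : D \proper 'N_U(D) -> 'N_U(D) \subset V ->
    V \subset W -> 'C_R(U :&: W) \subset 'C_R(D) /\ #|D| < #|U :&: W|.
  move=> ltD sNV sVW; have sNUW: 'N_U(D) \subset U :&: W.
    by rewrite subsetI subsetIl (subset_trans sNV).
  split; last exact: leq_trans (proper_card ltD) (subset_leq_card sNUW).
  by rewrite setIS ?centS // (subset_trans (proper_sub ltD)).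
have smaller (A B : {group gT}) : A \subset R -> #|D| < #|A :&: B| ->
    #|R| - #|A :&: B| < m.
  move=> sAR ltD; apply: leq_trans le_m.
  have leR: #|A :&: B| <= #|R| by rewrite subset_leq_card // subIset ?sAR.
  by rewrite ltn_sub2l // (leq_trans ltD).
have [sC0 lt0] := grow S S1 S2 ltNS sNS1 sS12.
have sT12: T1 \subset (S2 :^ c1)%G by rewrite defT1' conjSg.
have [sC2 lt2] := grow T T1 (S2 :^ c1)%G ltNT sNT1 sT12.
have [c0 Cc0 def2] := IHm S S2 (smaller _ _ sSR lt0) sylS sylS2.
rewrite (setIC T) in sC2 lt2.
have [c2 Cc2 defT] := IHm (S2 :^ c1)%G T (smaller _ _ (pHall_sub sylT2) lt2) sylT2 sylT.
(* The chain runs from [S] to [S2], to [S2 :^ c1], to [T]; each conjugating element centralises a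
   group containing [D]. *)
exists (c0 * c1 * c2); last by rewrite !conjsgM def2 -defT.
have C0 := subsetP sC0 _ Cc0; have C2 := subsetP sC2 _ Cc2.
exact: groupM (groupM C0 Cc1) C2.
Qed.

(** Conjugating [S :^ g] back to [S] by an element that centralises [x ^ g] replaces [g] by an
    element of ['N_R(S)], which is [S * 'C_R(S)]. *)
Lemma Sylow_control_fusion (S : {group gT}) x g : p.-Sylow(R) S ->
  g \in R -> x \in S -> x ^ g \in S -> exists2 s, s \in S & x ^ g = x ^ s.
Proof.
move=> sylS Rg Sx Sxg; have [sSR pS _] := and3P sylS.
have sylSg: p.-Sylow(R) (S :^ g)%G by rewrite pHallJ.
have [c /setIP[Rc cc] defS] := Sylow_conj_cent sylSg sylS.
have xgc: x ^ (g * c) = x ^ g.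
  rewrite conjgM; apply/conjg_fixP/commgP/commute_sym.
  by apply: (centP cc); rewrite inE memJ_conjg Sx.
have Ngc: g * c \in 'N_R(S).
  by rewrite inE groupM //=; apply/normP; rewrite conjsgM.
have sylSN: p.-Sylow('N_R(S)) S.
  by apply: pHall_subl (subsetIl _ _) sylS; rewrite subsetI sSR normG.
move: Ngc; rewrite (norm_eq_mul_cent pS sSR sylSN) => /mulsgP[s d Ss /setIP[_ Cd] e].
exists s => //; rewrite -xgc e conjgM; apply/conjg_fixP/commgP/commute_sym.
by apply: (centP Cd); rewrite groupJ.
Qed.

Lemma p'group_of_cent_p'elt :
  R \subset <<[set x in R | p^'.-elt x]>> -> p^'.-group R.
Proof.
move=> genR; have [S sylS] := Sylow_exists p R; have [sSR pS _] := and3P sylS.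
suffices S1: S :=: 1 by rewrite -partG_eq1 -(card_Hall sylS) S1 cards1.
have nS': S \subset 'N(S^`(1)) by rewrite der_norm.
pose f := restrm_morphism nS' (coset_morphism S^`(1)).
have abf: abelian (f @* S).
  by rewrite morphim_restrm setIid; apply: sub_der1_abelian.
pose tr := @transfer_morphism _ _ R S f abf.
have ker_tr: R \subset 'ker tr.
  apply: subset_trans genR _; rewrite gen_subG; apply/subsetP=> a.
  rewrite inE => /andP[Ra p'a]; apply/kerP=> //=.
  pose t := tr a; have ta: (t *+ #[a] = 0)%R.
    rewrite -[(t *+ _)%R]FinRing.Theory.zmodXgE -(morphX tr) // expg_order morph1 //.
  apply: val_inj; apply: (@coprime_expg_eq1 _ _ #|f @* S| #[a]).
  - by apply: (pnat_coprime (pi := p)) p'a; apply: morphim_pgroup.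
  - exact: expg_cardG (fmodP _).
  by rewrite -fmvalZ ta.
suffices: S \subset S^`(1).
  move=> sSS'; apply/eqP/contraT=> ntS.
  by have := proper_subn (sol_der1_proper (pgroup_sol pS) (subxx S) ntS); rewrite sSS'.
apply/subsetP=> g Sg; have Rg := subsetP sSR g Sg.
have := mker (subsetP ker_tr g Rg).
have [X trX] : {X | is_transversal X (rcosets S R :* <[g]>) R}.
  exists (transversal (rcosets S R :* <[g]>) R).
  by apply: transversalP; apply: rcosets_cycle_partition.
rewrite /= (transfer_cycle_expansion sSR abf Rg trX) //.
(* Each factor of the expansion is a conjugate in [S] of a power of [g]; by fusion it is already
   conjugate in [S], so it has the same image as that power. The exponents add up to [#|R : S|]. *)
rewrite (eq_bigr (fun x => fmod abf (f g) *+ #|<[g]> : S :* x|)%R); last first.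
  move=> x Xx; set n := #|_ : _|; have Rx := subsetP (transversal_sub trX) x Xx.
  have Sgx: (g ^+ n) ^ x^-1 \in S.
    rewrite conjgE invgK mulgA -mem_rcoset.
    exact: mulg_exp_card_rcosets.
  have [|s Ss e] := Sylow_control_fusion sylS (groupVr Rx) (groupX n Sg) _ => //.
  have fgs: f (g ^+ n ^ s) = f g ^+ n.
    rewrite morphJ ?groupX // morphX //; apply/conjg_fixP/commgP.
    by apply: (centsP abf); rewrite ?groupX ?mem_morphim.
  by rewrite e -[LHS]/(fmod abf (f (g ^+ n ^ s))) fgs fmodX ?mem_morphim.
rewrite GRing.sumrMnr (sum_index_rcosets_cycle sSR Rg trX) => gn0.
have fg: f g \in f @* S by rewrite mem_morphim.
have: f g = 1.
  apply: (@coprime_expg_eq1 _ _ #|f @* S| #|R : S|).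
  - apply: (pnat_coprime (pi := p)); first exact: morphim_pgroup.
    by case/and3P: sylS.
  - exact: expg_cardG fg.
  by rewrite -(fmodK abf fg) -fmvalZ gn0.
by move/(coset_idr (subsetP nS' g Sg)).
Qed.

End NormalizerFusion.

(** * Minimal normal failures and the residual of exponent [p - 1] *)

(** Closure under joins makes [V] the unique maximal [G]-normal subgroup properly inside [R]: the
    join of two such subgroups satisfies [P], so it cannot be [R]. *)
Lemma min_not_normal (gT : finGroupType) (G X : {group gT})
    (P : pred {group gT}) :
  P 1%G ->
  (forall K L : {group gT}, K <| G -> L <| G -> P K -> P L -> P (K <*> L)%G) ->
  X <| G -> ~~ P X ->
  exists R V : {group gT},
    [/\ R <| G, R \subset X, ~~ P R
      & [/\ V <| G, V \proper R, P V
          & forall K : {group gT}, K <| G -> K \proper R -> K \subset V]].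
Proof.
move=> P1 PY nsXG nPX; pose nP (K : {group gT}) := (K <| G) && ~~ P K.
have [R /mingroupP[/andP[nsRG nPR] minR] sRX] : {R : {group gT} | mingroup R nP & R \subset X}.
  by apply: mingroup_exists; rewrite /nP nsXG.
have PR (K : {group gT}) : K <| G -> K \proper R -> P K.
  move=> nsKG /andP[sKR]; apply: contraR => nPK.
  by rewrite (minR K) // /nP nsKG.
pose nV (K : {group gT}) := (K <| G) && (K \proper R).
have [V /maxgroupP[/andP[nsVG ltVR] maxV]] : {V : {group gT} | maxgroup V nV}.
  apply: ex_maxgroup; exists 1%G; rewrite /nV normal1 proper1G.
  by apply: contra nPR => /eqP/group_inj->.
exists R, V; split=> //; split=> // [|K nsKG ltKR]; first exact: PR.
have nsY : (K <*> V)%G <| G by rewrite normalY.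
rewrite -(maxV (K <*> V)%G) ?joing_subl ?joing_subr //.
rewrite /nV nsY properEneq join_subG (proper_sub ltKR) (proper_sub ltVR) !andbT.
by apply: contra nPR => /eqP/group_inj<-; apply: PY => //; apply: PR.
Qed.

Lemma p_index_mul_Sylow (gT : finGroupType) (p : nat) (G N S : {group gT}) :
  N \subset G -> p.-nat #|G : N| -> p.-Sylow(G) S -> N * S = G.
Proof.
move=> sNG pN sylS; apply: coprime_index_mulG (pHall_sub sylS) _ => //.
by apply: (pnat_coprime pN); case/and3P: sylS.
Qed.

(* What the partial Pi-property says about a [p]-subgroup [H] at the step where a
   chief series first covers [R]; unlike a chief series this passes to quotients
   by normal [p']-subgroups. *)
Definition partial_Pi_max (gT : finGroupType) (p : nat) (G H : {group gT}) :=
  forall V R : {group gT}, V <| G -> R <| G -> V \proper R ->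
    (forall K : {group gT}, K <| G -> K \proper R -> K \subset V) ->
    H \subset R -> ~~ (H \subset V) -> p.-nat #|G : 'N_G(H <*> V)|.

(* The intersection of the kernels of all homomorphisms from [G] to the cyclic
   group of order [p - 1]. *)
Definition res1 (gT : finGroupType) (p : nat) (G : {group gT}) : {group gT} :=
  (G^`(1) <*> <<[set x ^+ p.-1 | x in G]>>)%G.

Section Res1.

Variables (gT : finGroupType) (p : nat).
Hypothesis p_pr : prime p.
Implicit Types G V W K : {group gT}.

Lemma res1_sub G : res1 p G \subset G.
Proof.
rewrite join_subG der_sub gen_subG; apply/subsetP=> _ /imsetP[x Gx ->].
exact: groupX.
Qed.

Lemma res1_normal G : res1 p G <| G.
Proof. by apply: sub_der1_normal (joing_subl _ _) (res1_sub G). Qed.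

Lemma mem_res1_comm G x y : x \in G -> y \in G -> [~ x, y] \in res1 p G.
Proof. by move=> Gx Gy; apply: (subsetP (joing_subl _ _)); apply: mem_commg. Qed.

Lemma mem_res1_exp G x : x \in G -> x ^+ p.-1 \in res1 p G.
Proof.
move=> Gx; apply: (subsetP (joing_subr _ _)); apply: mem_gen.
by apply/imsetP; exists x.
Qed.

(** [G] acts on [W / V] through the automorphism group of a cyclic group of order [p], which is
    abelian of order [p - 1]. *)
Lemma res1_cent_factor G V W :
  V <| G -> W <| G -> V \subset W -> #|W / V| = p -> [~: W, res1 p G] \subset V.
Proof.
move=> nsVG nsWG sVW oW; have [_ nVG] := andP nsVG.
have nVW := subset_trans (normal_sub nsWG) nVG.
have nVD := subset_trans (res1_sub G) nVG.
rewrite -quotient_cents2 // centsC /=.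
have nWG: G / V \subset 'N(W / V) by rewrite quotient_norms ?normal_norm.
have cyc: cyclic (W / V) by rewrite prime_cyclic ?oW.
have kerC y: y \in G / V -> conj_aut (W / V) y = 1 -> y \in 'C(W / V).
  by move=> Gy y1; rewrite -ker_conj_aut; apply/kerP; rewrite ?(subsetP nWG).
have Aa y: y \in G / V -> conj_aut (W / V) y \in Aut (W / V).
  move=> Gy; apply: (subsetP (Aut_conj_aut _ 'N(W / V))).
  by rewrite mem_morphim ?(subsetP nWG).
rewrite quotientY ?(subset_trans (der_sub 1 G)) //; last first.
  by apply: subset_trans nVG; rewrite gen_subG; apply/subsetP=> _ /imsetP[x Gx ->]; apply: groupX.
rewrite join_subG; apply/andP; split.
  rewrite quotientR //; apply/subsetP=> y.
  have sC: [~: G / V, G / V] \subset 'C(W / V).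
    rewrite gen_subG; apply/subsetP=> _ /imset2P[u v Gu Gv ->].
    apply: kerC; first by rewrite groupR.
    rewrite morphR ?(subsetP nWG) //; apply/eqP/commgP.
    by apply: (centsP (Aut_cyclic_abelian cyc)); apply: Aa.
  exact: (subsetP sC).
rewrite quotient_gen; last first.
  by apply/subsetP=> _ /imsetP[x Gx ->]; rewrite (subsetP nVG) ?groupX.
rewrite gen_subG; apply/subsetP=> _ /morphimP[_ _ /imsetP[x Gx ->] ->].
rewrite morphX ?(subsetP nVG) //; apply: kerC; first by rewrite groupX ?mem_quotient.
rewrite morphX ?(subsetP nWG) ?mem_quotient //=.
have := expg_cardG (Aa _ (mem_quotient V Gx)).
by rewrite card_Aut_cyclic // oW totient_prime.
Qed.

End Res1.

(** * Consequences of the partial Pi-property for elements of order [p] and 4 *)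

Section SmallElements.

Variables (gT : finGroupType) (p : nat) (G X : {group gT}) (b4 : pred gT).

(** The predicate [b4] selects the elements whose order 4 is to count. It is left abstract because
    the section is applied in a quotient, whereas quaternion-freeness is tested on Sylow subgroups
    of the original group. *)
Let small (x : gT) := (#[x] == p) || (b4 x && (#[x] == 4)).

Hypotheses (p_pr : prime p) (nsXG : X <| G).
Hypothesis qfX : forall Q : {group gT},
  p.-group Q -> Q \subset X -> {in Q, forall x, b4 x} \/ quaternion_free Q.
Hypothesis PiX : forall x, x \in X -> p.-elt x -> small x -> partial_Pi_max p G <[x]>.

Let Fp_small (Q : {group gT}) a : p.-group Q -> Q \subset X ->
  a \in 'N(Q) -> p^'.-elt a -> (forall x, x \in Q -> small x -> [~ x, a] = 1) ->
  a \in 'C(Q).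
Proof.
move=> pQ sQX nQa p'a csmall; apply: (p'elt_cent_pgroup pQ) => // [x Qx ox | _].
  by apply: csmall => //; rewrite /small ox eqxx.
case: (qfX pQ sQX) => [b4Q | qfQ]; last by left.
by right=> x Qx ox; apply: csmall => //; rewrite /small b4Q // ox eqxx orbT.
Qed.

Lemma pgroup_of_small :
  (forall V : {group gT}, p.-group V -> V <| G -> V \subset X ->
     forall a, a \in X -> p^'.-elt a -> a \in 'C(V)) ->
  (forall R : {group gT}, p^'.-group R -> R <| G -> R \subset X -> R :=: 1) ->
  p.-group X.
Proof.
move=> cV no_p'; apply/contraT=> npX.
have [|K L nsKG nsLG pK pL|R [V [nsRG sRX npR [nsVG ltVR pV maxV]]]] :=
  @min_not_normal _ G X (fun K : {group gT} => p.-group K) _ _ nsXG npX.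
- exact: pgroup1.
- by rewrite /= norm_joinEr ?pgroupM ?pK // (subset_trans (normal_sub nsLG)) ?normal_norm.
have sVX := subset_trans (proper_sub ltVR) sRX.
pose L := <<[set x in R | p^'.-elt x]>>%G.
have sLR: L \subset R by rewrite gen_subG; apply/subsetP=> x /setIdP[].
have nsLG: L <| G.
  rewrite /normal (subset_trans sLR (normal_sub nsRG)) /=.
  apply: norms_gen; apply/subsetP=> g Gg; rewrite inE; apply/subsetP=> y.
  case/imsetP=> x /setIdP[Rx p'x] ->.
  by rewrite inE memJ_norm ?(subsetP (normal_norm nsRG)) // Rx p_eltJ.
have mL x : x \in R -> p^'.-elt x -> x \in L.
  by move=> Rx p'x; rewrite mem_gen // inE Rx.
(* Otherwise [L] would lie in the [p]-group [V], leaving [R] without nontrivial [p']-elements. *)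
have genR: R \subset L.
  apply/contraT=> nRL; have ltLR: L \proper R by rewrite properE sLR.
  case/negP: npR; apply: pgroup_of_p'elt_eq1 => x Rx p'x.
  have Vx := subsetP (maxV L nsLG ltLR) x (mL _ Rx p'x).
  have px := mem_p_elt pV Vx.
  by apply/eqP; rewrite -order_eq1 (pnat_1 px p'x).
have cVR: R \subset 'C(V).
  apply: subset_trans genR _; rewrite gen_subG; apply/subsetP=> x /setIdP[Rx p'x].
  by apply: (cV V) => //; apply: (subsetP sRX).
(* If [x] is outside [V], then [G] is the product of the normalizer of [W] and a Sylow subgroup [S]
   containing [W], so all conjugates of [W] lie in [S]. The normal closure of [W] is thus a
   [p]-group, properly inside [R], hence inside [V]. *)
have smallV x: x \in R -> p.-elt x -> small x -> x \in V.
  move=> Rx px sx; apply/contraT=> nVx; have Xx := subsetP sRX x Rx.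
  have sxR: <[x]> \subset R by rewrite cycle_subG.
  have nVsx: ~~ (<[x]> \subset V) by rewrite cycle_subG.
  have pi := PiX Xx px sx nsVG nsRG ltVR maxV sxR nVsx.
  pose W := (<[x]> <*> V)%G; rewrite -/(gval W) in pi.
  have sWR: W \subset R by rewrite join_subG sxR proper_sub.
  have sWG := subset_trans sWR (normal_sub nsRG).
  have pW: p.-group W.
    rewrite /= norm_joinEl ?pgroupM ?pV ?andbT //.
    by rewrite (subset_trans sxR) // cents_norm.
  have [S sylS sWS] := Sylow_superset sWG pW.
  have eG := p_index_mul_Sylow (subsetIl _ _) pi sylS.
  pose C := <<class_support W G>>%G.
  have nsCG: C <| G.
    rewrite /normal gen_subG norms_gen ?class_support_norm // andbT.
    by apply: class_support_subG.
  have sCS: C \subset S.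
    rewrite gen_subG; apply/subsetP=> _ /imset2P[w g Ww + ->].
    rewrite -eG => /mulsgP[n s /setIP[_ Nn] Ss ->]; rewrite conjgM groupJ //.
    by apply: (subsetP sWS); rewrite memJ_norm.
  have sCR: C \subset R.
    rewrite gen_subG class_support_sub_norm //.
    exact: normal_norm.
  have pC := pgroupS sCS (pHall_pgroup sylS).
  have [eCR | neCR] := eqVneq C R; first by rewrite -eCR pC in npR.
  case/negP: nVx; apply: (subsetP (maxV C nsCG _)).
    by rewrite properEneq neCR sCR.
  apply/mem_gen/imset2P; exists x 1; rewrite ?conjg1 //.
  by rewrite (subsetP (joing_subl _ _)) ?cycle_id.
have p'R: p^'.-group R.
  apply: p'group_of_cent_p'elt genR => Q a pQ sQR /setIP[Ra nQa] p'a.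
  apply: Fp_small (subset_trans sQR sRX) nQa p'a _ => // x Qx sx.
  have Vx := smallV x (subsetP sQR x Qx) (mem_p_elt pQ Qx) sx.
  by apply/eqP/commgP/commute_sym; apply: (centsP cVR a Ra x Vx).
by case/negP: npR; rewrite /= (no_p' R) ?pgroup1.
Qed.

(* [D] is the residual whose [p']-elements must centralise a normal [p]-subgroup
   for all chief factors of [G] below it to have order [p]. *)
Let D := res1 p G.
Let cz (K : {group gT}) := [forall a in D, p^'.-elt a ==> (a \in 'C(K))].

Let cz_commV (R V : {group gT}) : R <| G -> p.-group R -> cz V ->
  [~: R, D] \subset V -> cz R.
Proof.
move=> nsRG pR /forall_inP czV sRDV; apply/forall_inP=> a Da; apply/implyP=> p'a.
apply/centP=> x Rx; apply/commute_sym/commgP/eqP.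
have Ga := subsetP (res1_sub p G) a Da.
have nRa : a \in 'N(R) by rewrite (subsetP (normal_norm nsRG)).
apply: (@commute_comm_eq1 _ p) => //.
  by apply: (mem_p_elt pR); apply: comm_mem_norm.
have /implyP/(_ p'a)/centP := czV a Da; apply.
by apply: (subsetP sRDV); rewrite mem_commg.
Qed.

Let normal_pgroup_sub_Sylow (R S : {group gT}) :
  R <| G -> p.-group R -> p.-Sylow(G) S -> R \subset S.
Proof.
move=> nsRG pR sylS; apply: subset_trans (pcore_max pR nsRG) _.
by rewrite pcore_sub_Hall.
Qed.

Section MinimalStep.

Variables R V S : {group gT}.
Hypotheses (nsRG : R <| G) (pR : p.-group R).
Hypotheses (nsVG : V <| G) (ltVR : V \proper R).
Hypothesis (maxV : forall K : {group gT}, K <| G -> K \proper R -> K \subset V).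
Hypothesis (sylS : p.-Sylow(G) S).

Let nVG := normal_norm nsVG.
Let sVR := proper_sub ltVR.
Let sRG := normal_sub nsRG.
Let nVR := subset_trans sRG nVG.
Let sSG := pHall_sub sylS.
Let pS := pHall_pgroup sylS.
Let sRS := normal_pgroup_sub_Sylow nsRG pR sylS.
Let nVS := subset_trans sSG nVG.

Let ntRV : R / V != 1.
Proof. by rewrite -subG1 quotient_sub1 // proper_subn. Qed.

Let join_eq (W : {group gT}) : W <| G -> W \subset R -> ~~ (W \subset V) -> W :=: R.
Proof.
move=> nsWG sWR nWV; apply/eqP; rewrite eqEproper sWR; apply: contra nWV.
exact: maxV.
Qed.

Let expRp x : x \in R -> x ^+ p \in V.
Proof.
move=> Rx; have ltPhi: 'Phi(R) \proper R.
  by apply: Phi_proper; apply: contraNneq ntRV => ->; rewrite quotient1.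
apply: (subsetP (maxV _ ltPhi)); first exact: gFnormal_trans.
rewrite /= (Phi_joing pR); apply: mem_gen.
by rewrite inE -{2}(expn1 p) Mho_p_elt ?orbT ?(mem_p_elt pR).
Qed.

Let card_xV x : x \in R -> x \notin V -> #|(<[x]> <*> V) / V| = p.
Proof.
move=> Rx nVx; have nVx' := subsetP nVR x Rx.
rewrite quotientYidr ?cycle_subG // quotient_cycle // -orderE.
apply: nt_prime_order => //; first by rewrite -morphX //= coset_id ?expRp.
by apply: contraNneq nVx => /(coset_idr nVx').
Qed.

(** Since [S] fixes [x] modulo [V], it normalises [<[x]> <*> V]; the partial Pi-property supplies
    the rest of [G]. By maximality of [V] this subgroup is [R], so [R / V] has order [p]. *)
Lemma min_step_fixed x : x \in R -> x \notin V -> partial_Pi_max p G <[x]> ->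
  (forall s, s \in S -> [~ x, s] \in V) -> [~: R, D] \subset V.
Proof.
move=> Rx nVx pix fixS.
have sxR: <[x]> \subset R by rewrite cycle_subG.
have nVsx: ~~ (<[x]> \subset V) by rewrite cycle_subG.
have pN := pix V R nsVG nsRG ltVR maxV sxR nVsx.
pose W := (<[x]> <*> V)%G; rewrite -/(gval W) in pN.
have sWR: W \subset R by rewrite join_subG sxR.
have nWS: S \subset 'N(W).
  apply/subsetP=> s Ss; rewrite inE conjYg join_subG (normP (subsetP nVS s Ss)) joing_subr andbT.
  rewrite -cycleJ cycle_subG conjg_mulR groupM //.
    by rewrite (subsetP (joing_subl _ _)) ?cycle_id.
  by rewrite (subsetP (joing_subr _ _)) ?fixS.
have eG := p_index_mul_Sylow (subsetIl _ _) pN sylS.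
have nsWG: W <| G.
  rewrite /normal (subset_trans sWR) //= -eG mulG_subG nWS andbT.
  exact: subsetIr.
have eW: W :=: R.
  by apply: join_eq => //; apply: contra nVsx; apply: subset_trans (joing_subl _ _).
rewrite -eW; apply: res1_cent_factor => //; first exact: joing_subr.
exact: card_xV.
Qed.

(* For [W := <[x]> <*> V] we have [G = 'N_G(W) * S], and ['N_G(W)] centralises
   [W / V], which has order [2]; hence [[~: W, G] \subset [~: R, S] <*> V],
   a proper subgroup of [R]. *)
Lemma min_step_2 x : p = 2 -> x \in R -> x \notin V -> partial_Pi_max p G <[x]> ->
  [~: R, D] \subset V.
Proof.
move=> p2 Rx nVx pix.
have sxR: <[x]> \subset R by rewrite cycle_subG.
have nVsx: ~~ (<[x]> \subset V) by rewrite cycle_subG.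
have pN := pix V R nsVG nsRG ltVR maxV sxR nVsx.
pose W := (<[x]> <*> V)%G; rewrite -/(gval W) in pN.
have sWR: W \subset R by rewrite join_subG sxR.
have sVW : V \subset W := joing_subr _ _.
have eG := p_index_mul_Sylow (subsetIl _ _) pN sylS.
set N := 'N_G(W)%G in eG.
have sNG: N \subset G := subsetIl _ _.
have sWG := subset_trans sWR sRG.
have sWN: W \subset N by rewrite subsetI sWG normG.
have sWNV: [~: W, N] \subset V.
  have nsVN : V <| N := normalS (subset_trans sVW sWN) sNG nsVG.
  have nsWN : W <| N by rewrite /normal sWN subsetIr.
  apply: subset_trans (res1_cent_factor p_pr nsVN nsWN sVW (card_xV Rx nVx)).
  (* For [p = 2] the exponent [p.-1] is 1, so the residual of [N] is [N] itself. *)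
  apply/commgS/subsetP=> n Nn; have := mem_res1_exp p Nn.
  by rewrite p2 expg1.
pose T := ([~: R, S] <*> V)%G.
have ltTR: T \proper R.
  have sRSR: [~: R, S] \subset R by rewrite commg_subl (subset_trans sSG) ?normal_norm.
  have ltRS: [~: R / V, S / V] \proper R / V.
    apply: (nil_comm_properl (pgroup_nil (quotient_pgroup V pS))) => //.
      exact: quotientS.
    rewrite subsetI subxx quotient_norms //.
    by rewrite (subset_trans sSG) ?normal_norm.
  rewrite properE join_subG sRSR sVR /=.
  apply: contra (proper_subn ltRS) => sRT.
  rewrite -quotientR // -(quotientYidr (subset_trans sRSR nVR)).
  exact: quotientS.
have sWGT: [~: W, G] \subset T.
  rewrite gen_subG; apply/subsetP=> _ /imset2P[w g Ww + ->].
  rewrite -eG => /mulsgP[n s Nn Ss ->]; rewrite commgMJ groupM //.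
    apply: (subsetP (joing_subl _ _)); apply: mem_commg => //.
    exact: (subsetP sWR).
  apply: (subsetP (joing_subr _ _)); rewrite memJ_norm ?(subsetP nVS) //.
  by apply: (subsetP sWNV); apply: mem_commg.
have sWGV: [~: W, G] \subset V.
  apply: maxV (sub_proper_trans sWGT ltTR).
  rewrite /normal commg_normr andbT (subset_trans sWGT) //.
  exact: subset_trans (proper_sub ltTR) sRG.
have nsWG: W <| G.
  by rewrite /normal sWG -commg_subl (subset_trans sWGV).
have eW: W :=: R.
  by apply: join_eq => //; apply: contra nVsx; apply: subset_trans (joing_subl _ _).
by rewrite -eW (subset_trans _ sWGV) // commgS // res1_sub.
Qed.

Lemma exists_fixed : exists2 x, x \in R :\: V & forall s, s \in S -> [~ x, s] \in V.
Proof.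
have nsRV: R / V <| S / V.
  by rewrite quotient_normal // /normal sRS (subset_trans sSG) ?normal_norm.
have := meet_center_nil (pgroup_nil (quotient_pgroup V pS)) nsRV ntRV.
case/trivgPn=> y /setIP[/morphimP[x nVx Rx ->] /centerP[_ cx]] ntx.
exists x; first by rewrite inE Rx andbT; apply: contra ntx => Vx; rewrite /= coset_id.
move=> s Ss; have nVs := subsetP nVS s Ss; apply: coset_idr; first by rewrite groupR.
by rewrite morphR //; apply/eqP/commgP; apply: cx; rewrite mem_quotient.
Qed.

End MinimalStep.

(** For [p = 2] any small element outside [V] will do, and if there is none, the criterion on small
    elements applies to [R] directly. For odd [p] the element must also be fixed by [S] modulo [V];
    this is arranged by showing that [R] has exponent [p], so that every element outside [V] is
    small. *)
Lemma cent_res1_of_small : p.-group X ->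
  forall a, a \in D -> p^'.-elt a -> a \in 'C(X).
Proof.
move=> pX; suff czX: cz X by move=> a Da; apply/implyP/(forall_inP czX).
apply/contraT=> nczX.
have cz1: cz 1%G by apply/forall_inP=> a Da; rewrite cent1T inE implybT.
have czY (K L : {group gT}) : K <| G -> L <| G -> cz K -> cz L -> cz (K <*> L)%G.
  move=> _ _ /forall_inP czK /forall_inP czL; apply/forall_inP=> a Da.
  apply/implyP=> p'a; rewrite -sub_cent1 join_subG !sub_cent1.
  by rewrite (implyP (czK a Da)) ?(implyP (czL a Da)).
have [R [V [nsRG sRX nczR [nsVG ltVR czV maxV]]]] :=
  min_not_normal cz1 czY nsXG nczX.
have pR := pgroupS sRX pX; have [S sylS] := Sylow_exists p G.
case/negP: (nczR); apply: (cz_commV nsRG pR czV).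
have sRDG a: a \in D -> a \in 'N(R).
  by move=> Da; rewrite (subsetP (normal_norm nsRG)) ?(subsetP (res1_sub p G)).
have [p2 | p_odd] := eqVneq p 2.
  have [x /andP[Rx sx] nVx] : exists2 x, (x \in R) && small x & x \notin V.
    apply/exists_inP/contraT; rewrite negb_exists_in => /forall_inP sV.
    case/negP: nczR; apply/forall_inP=> a Da; apply/implyP=> p'a.
    apply: Fp_small => // [|x Rx sx]; first exact: sRDG.
    have /negPn Vx := sV x (introT andP (conj Rx sx)).
    apply/eqP/commgP/commute_sym.
    by apply: (centP (implyP (forall_inP czV a Da) p'a)).
  have px := mem_p_elt pR Rx.
  by apply: (min_step_2 nsRG pR nsVG ltVR maxV sylS p2 Rx nVx); apply: PiX => //; apply: (subsetP sRX).
have [C critC] := Thompson_critical pR.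
have chC: C \char R by case: critC.
have odd_p: odd p by case/even_prime: p_pr p_odd => [-> |].
have nsOG: 'Ohm_1(C)%G <| G.
  exact: char_normal_trans (char_trans (Ohm_char 1 C) chC) nsRG.
have sOR: 'Ohm_1(C) \subset R := subset_trans (Ohm_sub 1 C) (char_sub chC).
(* Were ['Ohm_1(C)] proper in [R], it would lie in [V]; the [p']-elements of [D] would then fix all
   elements of order [p] in [C], hence centralise [C], hence [R]. *)
have eO: 'Ohm_1(C) = R.
  apply/eqP; rewrite eqEproper sOR /=; apply: contra nczR => ltOR.
  have sOV := maxV _ nsOG ltOR.
  apply/forall_inP=> a Da; apply/implyP=> p'a; have nRa := sRDG a Da.
  apply: (cent_critical_p'elt pR critC) => //.
  apply: (p'elt_cent_pgroup (pgroupS (char_sub chC) pR)) => // [|x Cx ox|p2].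
  - by rewrite -cycle_subG (char_norm_trans chC) ?cycle_subG.
  - apply/eqP/commgP/commute_sym.
    apply: (centP (implyP (forall_inP czV a Da) p'a)); apply: (subsetP sOV).
    rewrite /= (OhmE 1 (pgroupS (char_sub chC) pR)) mem_gen // !inE Cx expn1.
    by rewrite -order_dvdn ox dvdnn.
  by rewrite p2 in p_odd.
have expR x: x \in R -> x ^+ p = 1.
  rewrite -eO => Ox; apply: (exponentP _ _ Ox).
  exact: exponent_Ohm1_class2 odd_p (pgroupS (char_sub chC) pR) (critical_class2 critC).
have [x /setDP[Rx nVx] fixS] := exists_fixed nsRG pR nsVG ltVR sylS.
apply: (min_step_fixed nsRG pR nsVG ltVR maxV sylS Rx nVx _ fixS).
apply: PiX; [exact: (subsetP sRX) | exact: mem_p_elt Rx | ].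
rewrite /small (nt_prime_order p_pr (expR x Rx)) ?eqxx //.
by apply: contraNneq nVx => ->.
Qed.

End SmallElements.

(** * [p]-quasinilpotent groups and the radical [gen_pFitting] *)

Section InnerAction.

Variable gT : finGroupType.
Implicit Types A U V W : {group gT}.

Lemma induces_innerP A U V : A \subset 'N(V) -> U \subset A ->
  reflect (forall a, a \in A -> exists2 z, z \in U &
             forall y, y \in U -> [~ y, a * z^-1] \in V)
          (induces_inner A U V).
Proof.
move=> nVA sUA; have nVU := subset_trans sUA nVA.
have eqJ y a z : y \in U -> a \in A -> z \in U ->
  (coset V y ^ coset V a == coset V y ^ coset V z) = ([~ y, a * z^-1] \in V).
  move=> Uy Aa Uz; have nVy := subsetP nVU y Uy; have nVz := subsetP nVU z Uz.
  have nVa := subsetP nVA a Aa.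
  rewrite -(inj_eq (conjg_inj (coset V z)^-1)) conjgK -conjgM.
  have nVaz: a * z^-1 \in 'N(V) by rewrite groupM ?groupV.
  have ->: coset V a * (coset V z)^-1 = coset V (a * z^-1).
    by rewrite morphM ?morphV ?groupV.
  rewrite (sameP eqP conjg_fixP) -morphR //=.
  by apply/eqP/idP=> [/coset_idr->|/coset_id //]; rewrite ?groupR.
apply: (iffP forall_inP) => inn a Aa.
  have /exists_inP[_ /morphimP[z nVz Uz ->] /forall_inP eqz] := inn a Aa.
  by exists z => // y Uy; rewrite -eqJ // eqz ?mem_quotient.
have [z Uz eqz] := inn a Aa; apply/exists_inP; exists (coset V z).
  exact: mem_quotient.
by apply/forall_inP=> _ /morphimP[y nVy Uy ->]; rewrite eqJ ?eqz.
Qed.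

Lemma pquasinilpotentP p A :
  reflect (forall U V, chief_factor A V U -> p %| #|U / V| -> induces_inner A U V)
          (pquasinilpotent p A).
Proof.
apply: (iffP forallP) => [qA U V ch pd | qA U].
  by have /forallP/(_ V)/implyP := qA U; apply; rewrite ch.
by apply/forallP=> V; apply/implyP=> /andP[ch pd]; apply: qA.
Qed.

Lemma chief_factorP A V U : chief_factor A V U ->
  [/\ V <| A, U <| A, V \proper U
    & forall K : {group gT}, K <| A -> V \subset K -> K \proper U -> K :=: V].
Proof.
case/andP=> /maxgroupP[/andP[ltVU nVA] maxV] nsUA; split=> //.
  by rewrite /normal nVA (subset_trans (proper_sub ltVU)) ?normal_sub.
by move=> K /andP[_ nKA] sVK ltKU; apply: maxV => //; rewrite ltKU.
Qed.

End InnerAction.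

(** A chief factor of order divisible by [p] cannot be covered by the [p']-group ['ker f], so it is
    carried isomorphically onto a chief factor of the image. *)
Lemma pquasinilpotent_of_morphim (gT rT : finGroupType) (p : nat)
    (A : {group gT}) (f : {morphism A >-> rT}) :
  prime p -> p^'.-group ('ker f) -> pquasinilpotent p (f @* A) ->
  pquasinilpotent p A.
Proof.
move=> p_pr p'K /pquasinilpotentP qf; apply/pquasinilpotentP=> U V ch pd.
have [nsVA nsUA ltVU maxV] := chief_factorP ch; have sVU := proper_sub ltVU.
have [sVA nVA] := andP nsVA; have [sUA nUA] := andP nsUA.
have nVU := subset_trans sUA nVA.
pose K := ('ker f)%G; have nsKA : K <| A := ker_normal f.
have sKUV: K :&: U \subset V.
  have nsY: ((K :&: U) <*> V)%G <| A by rewrite normalY // normalI.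
  have sYU: (K :&: U) <*> V \subset U by rewrite join_subG subsetIr.
  have [eYU | neYU] := eqVneq ((K :&: U) <*> V) U; last first.
    apply: subset_trans (joing_subl _ V) _.
    by rewrite /= (maxV ((K :&: U) <*> V)%G) ?joing_subr ?properEneq ?neYU.
  have: p^'.-group (U / V).
    rewrite -eYU quotientYidr ?(subset_trans (subsetIr _ _)) //.
    by apply: quotient_pgroup; apply: pgroupS (subsetIl _ _) p'K.
  by rewrite /pgroup p'natE // pd.
have fVU y: y \in U -> f y \in f @* V -> y \in V.
  move=> Uy /morphimP[v Av Vv efy]; have Ay := subsetP sUA y Uy.
  rewrite -(groupMr y (groupVr Vv)); apply: (subsetP sKUV).
  apply/setIP; split; last exact: groupM Uy (groupVr (subsetP sVU v Vv)).
  by apply/kerP; rewrite ?groupM ?groupV // morphM ?groupV // morphV // efy mulgV.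
have chf: chief_factor (f @* A) (f @* V) (f @* U).
  apply/andP; split; last exact: morphim_normal.
  apply/maxgroupP; split=> [|H /andP[ltHU nHA] sVH].
    rewrite morphim_norms // andbT properE morphimS //.
    apply: contra (proper_subn ltVU) => sfUV; apply/subsetP=> y Uy.
    by apply: fVU => //; apply: (subsetP sfUV); rewrite mem_morphim ?(subsetP sUA).
  pose H' := (f @*^-1 H :&: U)%G.
  have sHU := proper_sub ltHU.
  have fH': f @* H' = H.
    by rewrite /= setIC morphim_setIpre (setIidPr sHU).
  have nsH': H' <| A.
    have eA: f @*^-1 (f @* A) = A by rewrite morphimGK ?(normal_sub nsKA).
    have sHA: H \subset f @* A := subset_trans sHU (morphimS f sUA).
    rewrite normalI // -[X in _ <| X]eA morphpre_normal //.
    by rewrite /normal sHA.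
  rewrite -fH' (maxV H' nsH') //.
    by rewrite subsetI sVU andbT -sub_morphim_pre.
  rewrite properE subsetIr /=; apply: contra (proper_subn ltHU) => sUH'.
  by rewrite -fH' morphimS.
have pdf: p %| #|f @* U / f @* V|.
  have nfVU: f @* U \subset 'N(f @* V) by rewrite morphim_norms.
  have cf (B : {group gT}) : B \subset A -> (#|K :&: B| * #|f @* B|)%N = #|B|.
    by move=> sBA; rewrite card_morphim (setIidPr sBA) setIC LagrangeI.
  have eKI: K :&: U = K :&: V.
    by apply/eqP; rewrite eqEsubset subsetI subsetIl sKUV setIS.
  rewrite card_quotient // -divgS ?morphimS //.
  rewrite card_quotient // -divgS // -(cf _ sUA) -(cf _ sVA) eKI in pd.
  by rewrite divnMl ?cardG_gt0 in pd.
have /(induces_innerP _ _) inn := qf _ _ chf pdf.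
apply/induces_innerP => // a Aa.
have [||_ /morphimP[z Az Uz ->] eqz] := inn _ _ (f a) (mem_morphim f Aa Aa).
- by rewrite morphim_norms.
- by rewrite morphimS.
exists z => // y Uy; have Ay := subsetP sUA y Uy.
apply: fVU.
  by apply: comm_mem_norm => //; rewrite groupM ?groupV ?(subsetP nUA).
have -> : f [~ y, a * z^-1] = [~ f y, f a * (f z)^-1].
  by rewrite morphR ?morphM ?morphV ?groupM ?groupV.
exact: eqz (mem_morphim f Ay Uy).
Qed.

(** [M] is generated by its minimal normal subgroups, since they generate a characteristic subgroup.
    Each of them lies in [U] or meets it trivially, and in the latter case centralises it. *)
Lemma charsimple_mul_cent (gT : finGroupType) (M U : {group gT}) :
  charsimple M -> U <| M -> M \subset U * 'C(U).
Proof.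
move=> csM nsUM; have [sUM nUM] := andP nsUM.
have [ntM simM] := charsimpleP _ csM.
pose S := <<\bigcup_(T : {group gT} | (T \subset M) && minnormal T M) T>>%G.
have sSM: S \subset M by rewrite gen_subG; apply/bigcupsP=> T /andP[].
have sST (T : {group gT}) : T \subset M -> minnormal T M -> T \subset S.
  by move=> sTM minT; apply: sub_gen; apply: (bigcup_max T) => //; rewrite sTM.
have chS: S \char M.
  apply/charP; split=> // f injf fM; apply/eqP; rewrite eqEcard card_injm // leqnn andbT.
  rewrite /= morphim_gen; last by apply/bigcupsP=> T /andP[].
  rewrite gen_subG; apply/subsetP=> _ /morphimP[x Mx /bigcupP[T /andP[sTM minT] Tx] ->].
  have sfT: f @* T \subset M by have := morphimS f sTM; rewrite fM.
  apply: (subsetP (sST (f @* T)%G sfT _)); last exact: mem_morphim.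
  have: minnormal (f @* T) (f @* M) by rewrite injm_minnormal.
  by rewrite fM.
have [T minT sTM] := minnormal_exists ntM (normG M).
have ntT: T :!=: 1 by have /mingroupP[/andP[]] := minT.
have eS: S :=: M.
  apply: simM => //; apply: contraNneq ntT => S1.
  by rewrite -subG1 -S1 sST.
have nYM: M \subset 'N(U * 'C_M(U)).
  by rewrite normsM // normsI ?normG ?norms_cent.
have sYM : {subset U * 'C_M(U) <= U * 'C(U)}.
  by apply/subsetP; rewrite mulgS ?subsetIr.
pose Y := (U <*> 'C_M(U))%G.
have eY: Y :=: U * 'C_M(U).
  by rewrite /= norm_joinEr // (subset_trans (subsetIl _ _)).
suff: S \subset Y by rewrite eS eY => /subset_trans; apply; apply/subsetP.
rewrite gen_subG; apply/bigcupsP=> L /andP[sLM minL].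
have /mingroupP[/andP[ntL nLM] minL'] := minL.
have [TI | nTI] := eqVneq (L :&: U) 1.
  apply: subset_trans (joing_subr _ _); rewrite subsetI sLM.
  apply/commG1P/trivgP; rewrite -TI subsetI commg_subl commg_subr.
  by rewrite (subset_trans sUM) // (subset_trans sLM).
rewrite -(minL' (L :&: U)%G) ?nTI ?subsetIl ?normsI //.
exact: subset_trans (subsetIr _ _) (joing_subl _ _).
Qed.

Section GenPFitting.

Variables (gT : finGroupType) (p : nat).
Hypothesis p_pr : prime p.
Implicit Types E G M N U V : {group gT}.

Lemma pquasinilpotent_sub_gen_pFitting E N :
  N <| E -> pquasinilpotent p N -> N \subset gen_pFitting p E.
Proof.
by move=> nsN qN; apply: sub_gen; apply: (bigcup_max N) => //; rewrite nsN.
Qed.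

Lemma gen_pFitting_sub E : gen_pFitting p E \subset E.
Proof. by rewrite gen_subG; apply/bigcupsP=> N /andP[/andP[]]. Qed.

Lemma gen_pFitting_normal G E : E <| G -> gen_pFitting p E <| G.
Proof.
move=> nsEG; rewrite /normal (subset_trans (gen_pFitting_sub E) (normal_sub nsEG)).
apply: norms_gen; apply/subsetP=> g Gg; rewrite inE; apply/subsetP=> y.
case/imsetP=> x /bigcupP[N /andP[nsNE qN] Nx] ->; apply/bigcupP.
have nEg: E :^ g = E by apply: (normP (subsetP (normal_norm nsEG) g Gg)).
exists (N :^ g)%G; last by rewrite /= memJ_conjg.
rewrite -{1}nEg normalJ nsNE.
(* Conjugation by [g^-1] is injective, so its kernel is trivially a [p']-group. *)
apply: (@pquasinilpotent_of_morphim _ _ _ (N :^ g)%G (conjgm_morphism (N :^ g) g^-1)) => //.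
  by rewrite /= (trivgP (injm_conj _ _)); apply: pgroup1.
suff -> : (conjgm (N :^ g) g^-1 @* (N :^ g))%G = N by [].
by apply/val_inj; rewrite /= morphim_conj setIid conjsgK.
Qed.

(** On a chief factor of [M] inside a [p]-group, [a] acts like an element [z] of that [p]-group. The
    action then has order both a power of [p] and prime to [p], so it is trivial; induction up the
    series gives the claim inside [M]. *)
Lemma pquasinilpotent_cent_pgroup E M V a : M <| E -> pquasinilpotent p M ->
  V <| E -> p.-group V -> a \in M -> p^'.-elt a -> a \in 'C(V).
Proof.
move=> nsME /pquasinilpotentP qM nsVE pV Ma p'a.
have [sME nME] := andP nsME; have [sVE nVE] := andP nsVE.
have nVa: a \in 'N(V) by rewrite (subsetP nVE) // (subsetP sME).
have cU (U : {group gT}) : U <| M -> U \subset V -> a \in 'C(U).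
  have [m] := ubnP #|U|; elim: m U => // m IHm U leUm nsUM sUV.
  have [-> | ntU] := eqVneq U 1%G; first by rewrite cent1T inE.
  have [sUM nUM] := andP nsUM; have pU := pgroupS sUV pV.
  have [W maxW]: {W : {group gT} | maxnormal W U M}.
    by apply: ex_maxgroup; exists 1%G; rewrite proper1G ntU norms1.
  have ch: chief_factor M W U by rewrite /chief_factor maxW.
  have [nsWM _ ltWU _] := chief_factorP ch; have nWM := normal_norm nsWM.
  have sWU := proper_sub ltWU; have nWU := subset_trans sUM nWM.
  have cWa: a \in 'C(W).
    apply: IHm (subset_trans sWU sUV) => //.
    exact: leq_trans (proper_card ltWU) leUm.
  have ntUW: U / W != 1 by rewrite -subG1 quotient_sub1 // proper_subn.
  have [_ pd _] := pgroup_pdiv (quotient_pgroup W pU) ntUW.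
  have /(induces_innerP nWM sUM)/(_ a Ma)[z Uz cz] := qM U W ch pd.
  have nUWM: M / W \subset 'N(U / W) by rewrite quotient_norms.
  have Nw x: x \in M -> coset W x \in 'N(U / W).
    by move=> Mx; apply: (subsetP nUWM); apply: mem_quotient.
  have nW x: x \in M -> x \in 'N(W) by apply: (subsetP nWM).
  have Mz := subsetP sUM z Uz.
  pose al := conj_aut (U / W).
  have eal: al (coset W a) = al (coset W z).
    apply/eqP; rewrite eq_mulgV1 -morphV ?Nw // -morphM ?Nw ?groupV ?Nw //=.
    rewrite -morphV ?nW // -morphM ?groupV ?nW //=.
    apply/eqP/kerP; first by rewrite Nw ?groupM ?groupV.
    rewrite ker_conj_aut; apply/centP=> _ /morphimP[y nWy Uy ->].
    have My := subsetP sUM y Uy.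
    apply/commute_sym/commgP; rewrite -morphR ?groupM ?groupV ?nW //.
    by apply/eqP/coset_id; apply: cz.
  have al1: al (coset W a) = 1.
    apply: (@coprime_expg_eq1 _ _ #[z] #[a]).
    - exact: p_p'elt_coprime_order (mem_p_elt pU Uz) p'a.
    - by rewrite eal -morphX ?Nw //= -morphX ?nW //= expg_order !morph1.
    by rewrite -morphX ?Nw //= -morphX ?nW //= expg_order !morph1.
  have: coset W a \in 'C(U / W).
    by rewrite -ker_conj_aut; apply/kerP; rewrite ?Nw.
  move/centP=> cUa; apply/centP=> x Ux; apply/commute_sym/commgP/eqP.
  apply: (@commute_comm_eq1 _ p) => //.
    exact: mem_p_elt pU (comm_mem_norm Ux (subsetP nUM a Ma)).
  have Mx := subsetP sUM x Ux.
  apply: (centP cWa); apply: coset_idr; first by rewrite groupR ?nW.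
  rewrite morphR ?nW //; apply/eqP/commgP/commute_sym/cUa.
  exact: mem_quotient.
(* [V] need not lie in [M], but the commutators [[~ x, a]] with [x] in [V] do, so [a] centralises
   them. *)
have nsVM: (V :&: M)%G <| M.
  by rewrite /normal subsetIr normsI ?normG // (subset_trans sME).
apply/centP=> x Vx; apply/commute_sym/commgP/eqP.
have Vw: [~ x, a] \in V by apply: comm_mem_norm.
apply: (@commute_comm_eq1 _ p) => //; first exact: mem_p_elt pV Vw.
apply: (centP (cU _ nsVM (subsetIl _ _))); rewrite inE Vw /=.
by rewrite commgEr groupM // memJ_norm ?groupV // (subsetP nME) // (subsetP sVE).
Qed.

(** The argument works on the generators: each has a normal [p]-subgroup as image in [E / 'C_E(V)],
    so the whole radical maps into ['O_p(E / C)], where a [p']-element is trivial. *)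
Lemma gen_pFitting_cent_pgroup E V a : V <| E -> p.-group V ->
  a \in gen_pFitting p E -> p^'.-elt a -> a \in 'C(V).
Proof.
move=> nsVE pV Xa p'a; have [sVE nVE] := andP nsVE.
pose C := 'C_E(V)%G.
have nsC: C <| E.
  by rewrite /normal subsetIl normsI ?normG ?norms_cent.
have [_ nCE] := andP nsC.
have sXE := gen_pFitting_sub E.
have sXO: gen_pFitting p E / C \subset 'O_p(E / C).
  rewrite quotient_gen; last first.
    by apply: subset_trans nCE; apply: subset_trans sXE; apply: subset_gen.
  rewrite gen_subG; apply/subsetP=> _ /morphimP[x nCx /bigcupP[M /andP[nsME qM] Mx] ->].
  have pMC: p.-group (M / C).
    apply: pgroup_quotient_p'elt => [|y My p'y].
      exact: subset_trans (normal_sub nsME) nCE.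
    rewrite inE (subsetP (normal_sub nsME)) //=.
    exact: pquasinilpotent_cent_pgroup nsME qM nsVE pV My p'y.
  apply: (subsetP (pcore_max pMC _)); first exact: quotient_normal.
  exact: mem_quotient.
have Ea := subsetP sXE a Xa.
have pa: p.-elt (coset C a).
  apply: mem_p_elt (pcore_pgroup p (E / C)) _.
  by apply: (subsetP sXO); apply: mem_quotient.
have p'Ca: p^'.-elt (coset C a) by rewrite morph_p_elt ?(subsetP nCE).
have: coset C a = 1 by apply/eqP; rewrite -order_eq1 (pnat_1 pa p'Ca).
by move/(coset_idr (subsetP nCE a Ea)); case/setIP.
Qed.

(** A chief factor [U / W] of [M] is either covered by the central subgroup [V :&: U], with trivial
    action, or [V :&: U] lies in [W]. In the second case [M / V] is the product of the image of [U]
    and its centraliser, so [a] acts as some element of [U]. *)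
Lemma pquasinilpotent_central_chief E V M :
  chief_factor E V M -> M \subset 'C(V) -> pquasinilpotent p M.
Proof.
move=> ch cMV; have [nsVE nsME ltVM _] := chief_factorP ch.
have sVM := proper_sub ltVM; have nVM := subset_trans (normal_sub nsME) (normal_norm nsVE).
have csM: charsimple (M / V) := minnormal_charsimple (chief_factor_minnormal ch).
apply/pquasinilpotentP=> U W chU _.
have [nsWM nsUM ltWU maxW] := chief_factorP chU.
have [sUM nUM] := andP nsUM; have sWU := proper_sub ltWU.
have nWM := normal_norm nsWM; have nVU := subset_trans sUM nVM.
apply/induces_innerP => // a Ma.
pose Y := ((V :&: U) <*> W)%G.
have nsVM : V <| M by rewrite /normal sVM.
have nsY: Y <| M by rewrite normalY ?normalI.
have sYU: Y \subset U by rewrite join_subG subsetIr.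
have [eY | neY] := eqVneq Y U.
  exists 1; rewrite ?group1 // invg1 mulg1 => y.
  rewrite -eY /= norm_joinEl; last first.
    by rewrite (subset_trans (subsetIr _ _)) // (subset_trans sUM).
  case/mulsgP=> v w /setIP[Vv _] Ww ->; rewrite commMgJ.
  have -> : [~ v, a] = 1 by apply/eqP/commgP/commute_sym/(centsP cMV).
  by rewrite conj1g mul1g comm_mem_norm ?(subsetP nWM).
have eYW : Y = W :> {set gT}.
  by apply: maxW => //; [apply: joing_subr | rewrite properEneq neY].
have sVUW: V :&: U \subset W by rewrite -eYW joing_subl.
have: coset V a \in 'C(U / V) * (U / V).
  rewrite -(normC (norms_cent (normG _))); apply: (subsetP (charsimple_mul_cent csM (quotient_normal V nsUM))).
  exact: mem_quotient.
case/mulsgP=> c _ Cc /morphimP[z nVz Uz ->] ea; exists z => // y Uy.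
have nV x: x \in M -> x \in 'N(V) by apply: (subsetP nVM).
have Mz := subsetP sUM z Uz; have My := subsetP sUM y Uy.
have nUaz : a * z^-1 \in 'N(U).
  by rewrite (subsetP nUM) // groupM ?groupV.
apply: (subsetP sVUW); rewrite inE (comm_mem_norm Uy nUaz) andbT.
apply: coset_idr; first by rewrite groupR ?groupM ?groupV ?nV.
rewrite morphR ?groupM ?groupV ?nV //= morphM ?groupV ?nV //= morphV ?nV //= ea.
rewrite mulgK; apply/eqP/commgP/commute_sym.
exact: (centP Cc) (mem_quotient V Uy).
Qed.

(** A minimal [E]-normal subgroup [M] of the centraliser not inside [X] has [M / (M :&: X)] as a
    chief factor over a central subgroup; it is therefore [p]-quasinilpotent and lies in [X] after
    all. *)
Lemma cent_gen_pFitting E : 'C_E(gen_pFitting p E) \subset gen_pFitting p E.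
Proof.
set X := gen_pFitting p E; have nsXE: X <| E := gen_pFitting_normal (normal_refl E).
have [sXE nXE] := andP nsXE.
apply/contraT=> nCX; pose Q (K : {group gT}) := [&& K <| E, K \subset 'C_E(X) & ~~ (K \subset X)].
have [M /mingroupP[/and3P[nsME sMC nMX] minM]]: {M : {group gT} | mingroup M Q}.
  apply: ex_mingroup; exists 'C_E(X)%G; rewrite /Q nCX subxx !andbT.
  by rewrite /normal subsetIl normsI ?normG ?norms_cent.
case/negP: (nMX); apply: pquasinilpotent_sub_gen_pFitting => //.
have nsVE: (M :&: X)%G <| E by apply: normalI.
apply: (@pquasinilpotent_central_chief E (M :&: X)%G); last first.
  apply: subset_trans sMC _; apply: subset_trans (subsetIr _ _) _.
  by rewrite centS ?subsetIr.
rewrite /chief_factor nsME andbT; apply/maxgroupP; split.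
  rewrite (normal_norm nsVE) andbT properE subsetIl /=.
  by rewrite subsetI subxx.
move=> K /andP[/andP[sKM nMK] nKE] sVK; apply/eqP; rewrite eqEsubset sVK andbT.
rewrite subsetI sKM /=; apply: contraR nMK => nKX.
rewrite -{1}(minM K) ?subxx // /Q nKX (subset_trans sKM sMC) andbT.
by rewrite /normal nKE (subset_trans sKM) ?normal_sub.
Qed.

End GenPFitting.

(** * Quotients of quaternion-free groups, and the index given by the partial Pi-property *)

Lemma quaternion_free_morphim (aT rT : finGroupType) (D P : {group aT})
    (f : {morphism D >-> rT}) :
  P \subset D -> quaternion_free P -> quaternion_free (f @* P)%G.
Proof.
move=> sPD /forallP qfP; apply/forallP=> A; apply/forallP=> B.
apply/implyP=> /andP[sAP nsBA]; have [sBA nBA] := andP nsBA.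
pose A1 := (f @*^-1 A :&: P)%G.
have fA1: f @* A1 = A by rewrite /= setIC morphim_setIpre (setIidPr sAP).
have sA1D: A1 \subset D := subset_trans (subsetIr _ _) sPD.
pose g := comp_morphism f (coset_morphism B).
have sA1g: A1 \subset f @*^-1 'N(B).
  by rewrite -sub_morphim_pre // fA1.
have := first_isog_loc g sA1g.
rewrite morphim_comp fA1 => isoA.
have /forallP/(_ ('ker_A1 g)%G)/implyP := qfP A1.
have nsk: 'ker_A1 g <| A1 := normalGI sA1g (ker_normal g).
rewrite subsetIr /= nsk => /(_ isT).
by apply: contra => iso8; apply: isog_trans isoA iso8.
Qed.

Section PartialPi.

Variables (gT : finGroupType) (p : nat) (G N : {group gT}).
Hypotheses (p_pr : prime p) (nsNG : N <| G) (p'N : p^'.-group N).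
Implicit Types H K L R V : {group gT}.

(* In the first step of the chief series at which [K <*> N] covers [R], the
   coprime orders force [H] into the upper term. *)
Lemma partial_Pi_index H V R : p.-group H -> H \subset R -> partial_Pi G H ->
  V <| G -> R <| G -> N \subset V -> V \proper R ->
  (forall K, K <| G -> N \subset K -> K \proper R -> K \subset V) ->
  p.-nat #|G : 'N_G(H <*> V)|.
Proof.
move=> pH sHR [s [ch_s last_s Pi_s]] nsVG nsRG sNV ltVR maxV.
have [sRG nRG] := andP nsRG; have [sVG nVG] := andP nsVG.
have sVR := proper_sub ltVR; have sNR := subset_trans sNV sVR.
have sHG := subset_trans sHR sRG.
pose covers K := R \subset K <*> N.
have nc1: ~~ covers 1%G.
  by rewrite /covers joing1G; apply: contra (proper_subn ltVR) => /subset_trans->.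
have cG: covers (last 1%G s).
  by rewrite last_s; apply: subset_trans sRG (joing_subl _ _).
have has_s: has covers s.
  case: s last_s cG {ch_s Pi_s} => [_ c1 | K s _ cG]; first by rewrite c1 in nc1.
  by apply/hasP; exists (last K s) => //; apply: mem_last.
pose i := find covers s; have lti: i < size s by rewrite -has_find.
have := Pi_s i lti; have /(pathP 1%G)/(_ i lti) := ch_s.
set K := nth _ (1%G :: s) i; set L := nth _ s i => ch /=.
have ncK: ~~ covers K.
  rewrite /K; case ei: i => [|j] //.
  have lt_j: j < find covers s by rewrite -/i ei.
  by rewrite (before_find _ lt_j).
have cL: covers L by apply: nth_find.
have [nsKG nsLG ltKL _] := chief_factorP ch.
have [sKG nKG] := andP nsKG; have [sLG nLG] := andP nsLG.
have nKH := subset_trans sHG nKG.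
have sHL: H \subset L.
  apply/subsetP=> h Hh; apply: coset_idr; first by rewrite (subsetP nLG) ?(subsetP sHG).
  have NLh: coset L h \in N / L.
    rewrite -(quotientYidl (subset_trans (normal_sub nsNG) nLG)).
    by apply: mem_quotient; apply: (subsetP cL); apply: (subsetP sHR).
  have ph: p.-elt (coset L h).
    apply: (mem_p_elt (quotient_pgroup L pH)); exact: mem_quotient.
  have p'h: p^'.-elt (coset L h) := mem_p_elt (quotient_pgroup L p'N) NLh.
  by apply/eqP; rewrite -order_eq1 (pnat_1 ph p'h).
(* As [K] does not cover [R], the subgroup [(K :&: R) <*> N] is proper in [R], so maximality of [V]
   applies. *)
have sKRV: K :&: R \subset V.
  apply: subset_trans (joing_subl _ N) _; apply: (maxV ((K :&: R) <*> N)%G).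
  - by rewrite normalY // normalI.
  - exact: joing_subr.
  rewrite properE join_subG subsetIr sNR /=; apply: contra ncK => sRK.
  by apply: subset_trans sRK _; rewrite genS // setSU // subsetIl.
have -> : (H * K) / K :&: L / K = H / K.
  by rewrite quotientMidr (setIidPl _) // quotientS.
move=> piX; have {piX} pX: p.-nat #|G / K : 'N_(G / K)(H / K)|.
  apply: sub_in_pnat piX => q _ /=; rewrite mem_primes => /and3P[q_pr _ q_dv].
  exact: (pgroupP (quotient_pgroup K pH)).
pose P0 := (G :&: coset K @*^-1 'N_(G / K)(H / K))%G.
have P0K: P0 / K = 'N_(G / K)(H / K).
  by rewrite /= quotientGI ?cosetpreK ?setIA ?setIid.
have sKP0: K \subset P0.
  by rewrite subsetI sKG; apply: sub_cosetpre.
have sP0G: P0 \subset G := subsetIl _ _.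
have eP0: #|G / K : 'N_(G / K)(H / K)| = #|G : P0|.
  rewrite -P0K index_quotient_eq //; exact: subset_trans (subsetIr _ _) sKP0.
rewrite eP0 in pX; apply: (pnat_dvd _ pX).
(* An element normalising [H] modulo [K] sends [H] into [(H <*> K) :&: R], which is [H * (K :&: R)]
   by the modular law and so lies in [H <*> V]. *)
apply: indexgS; rewrite subsetI sP0G /=; apply/subsetP=> g /setIP[Gg].
case/morphpreP=> nKg /setIP[_ Ng].
rewrite inE conjYg (normP (subsetP nVG g Gg)) join_subG joing_subr andbT.
apply/subsetP=> _ /imsetP[h Hh ->].
have nKh := subsetP nKH h Hh.
have nsKHK: K <| (H <*> K)%G.
  by rewrite /normal joing_subr join_subG nKH normG.
have: h ^ g \in H <*> K.
  rewrite -(quotientGK nsKHK) inE groupJ //= quotientYidr // inE morphJ //=.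
  by rewrite memJ_norm // mem_quotient.
have Rhg: h ^ g \in R.
  by rewrite memJ_norm ?(subsetP sHR) // (subsetP nRG).
rewrite norm_joinEl // => HKhg.
have: h ^ g \in H * (K :&: R) by rewrite group_modl // inE HKhg.
by apply: subsetP; rewrite mul_subG ?joing_subl // (subset_trans sKRV) ?joing_subr.
Qed.

End PartialPi.

(** * Chief factors of prime order, and the reduction modulo a normal [p']-subgroup *)

Section FixedEigenvalue.

Import GRing.Theory.
Local Open Scope ring_scope.

(** [A] is annihilated by the product of all ['X - a], so one of the matrices [A - a] is
    singular. *)
Lemma fixed_eigenvalue (F : finFieldType) (n : nat) (A : 'M[F]_n.+1) :
  (A ^+ #|F| = A)%R -> exists a, eigenvalue A a.
Proof.
move=> AF; apply/existsP/contraT; rewrite negb_exists => /forallP nA.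
have: (horner_mx A ('X^#|F| - 'X) = 0)%R.
  by rewrite rmorphB rmorphXn /= horner_mx_X AF subrr.
rewrite finField_genPoly rmorph_prod /= => /(congr1 (fun B : 'M_n.+1 => \det B)).
rewrite det0 (big_morph (fun B : 'M_n.+1 => \det B) (@det_mulmx _ _) (det1 _ _)).
move/eqP/prodf_eq0=> [a _].
rewrite rmorphB /= horner_mx_X horner_mx_C => /det0P[u nzu uA].
case/negP: (nA a); apply/eigenvalueP; exists u => //.
by move/eqP: uA; rewrite mulmxBr subr_eq0 mul_mx_scalar => /eqP.
Qed.

End FixedEigenvalue.

Section MinNormalPgroup.

Variables (gT : finGroupType) (p : nat) (G M : {group gT}).
Hypotheses (p_pr : prime p) (sMG : M \subset G) (pM : p.-group M).
Hypothesis minM : minnormal M G.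

Let ntM : M :!=: 1. Proof. by case/mingroupP: minM => /andP[]. Qed.
Let nMG : G \subset 'N(M). Proof. by case/mingroupP: minM => /andP[]. Qed.

(** [D] is the product of ['C_D(M)] and a [p]-group, so [[~: M, D]] lies in [[~: M, S]], which is
    proper in [M] because [S] is nilpotent. Minimality of [M] then forces it to be trivial. *)
Lemma minnormal_cent_of_p'elt (D : {group gT}) : D <| G ->
  (forall a, a \in D -> p^'.-elt a -> a \in 'C(M)) -> D \subset 'C(M).
Proof.
move=> nsDG cD; have [sDG nDG] := andP nsDG; have [S sylS] := Sylow_exists p G.
have [sSG pS _] := and3P sylS.
have sMS: M \subset S.
  have nsMG: M <| G by rewrite /normal sMG.
  by apply: subset_trans (pcore_max pM nsMG) _; rewrite pcore_sub_Hall.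
pose L := 'C_D(M)%G.
have nLD: D \subset 'N(L).
  by rewrite normsI ?normG // norms_cent // (subset_trans sDG).
have pDL: p.-group (D / L).
  by apply: pgroup_quotient_p'elt => // a Da p'a; rewrite inE Da cD.
have sylSD: p.-Sylow(D) (S :&: D)%G.
  exact: Hall_setI_normal nsDG sylS.
have defD: D :=: L * (S :&: D).
  apply/eqP; rewrite eqEsubset mulG_subG subsetIl subsetIr !andbT.
  rewrite -quotientSK //.
  have := quotient_pHall (subset_trans (subsetIr S D) nLD) sylSD.
  by move/(pHall_id)/(_ pDL)=> <-.
have sMDS: [~: M, D] \subset [~: M, S].
  rewrite gen_subG; apply/subsetP=> _ /imset2P[m d Mm + ->].
  rewrite defD => /mulsgP[l s Ll /setIP[Ss _] ->]; rewrite commgMJ.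
  have -> : [~ m, l] = 1.
    by apply/eqP/commgP/commute_sym; case/setIP: Ll => _ /centP; apply.
  by rewrite conj1g mulg1 mem_commg.
have ltMD: [~: M, D] \proper M.
  apply: sub_proper_trans sMDS _; apply: (nil_comm_properl (pgroup_nil pS)) => //.
  by rewrite subsetI subxx (subset_trans sSG).
apply/commG1P; rewrite commGC; apply/eqP/contraT=> ntMD.
have /mingroupP[_ /(_ [~: M, D]%G)] := minM.
rewrite ntMD normsR // (proper_sub ltMD) => /(_ isT isT) eMD.
by move: (proper_neq ltMD); rewrite /= eMD eqxx.
Qed.

(** Each [g] in [G] acts on [M] as its [p]-th power does, so it has an eigenvector over the field of
    order [p]. Commutators act trivially, hence the eigenspace is [G]-invariant and equals [M]. All
    of [G] acts by scalars, and every cyclic subgroup of [M] is normalised. *)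
Lemma minnormal_prime_of_res1 : res1 p G \subset 'C(M) -> #|M| = p.
Proof.
move=> cD; have nsMG: M <| G by rewrite /normal sMG.
have abelM: p.-abelem M.
  have [_ _ ] := minnormal_solvable minM (subxx M) (pgroup_sol pM).
  case/is_abelemP=> q q_pr abq; have [_ pd _] := pgroup_pdiv pM ntM.
  by have := pgroupP (abelem_pgroup abq) p p_pr pd; rewrite inE => /eqP->.
have abM := abelem_abelian abelM.
have power g : g \in G -> exists k, {in M, forall m, m ^ g = m ^+ k}.
  move=> Gg; pose rG := abelem_repr abelM ntM nMG.
  have rGp: (rG g ^+ #|'F_p| = rG g)%R.
    have /rkerP[_ rg1]: g ^+ p.-1 \in rker rG.
      by rewrite rker_abelem inE groupX //= (subsetP cD) ?mem_res1_exp.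
    have gp: g ^+ p = g * g ^+ p.-1 by rewrite -expgS prednK ?prime_gt0.
    rewrite card_Fp // -repr_mxX // gp.
    by rewrite repr_mxM ?groupX // rg1 mulmx1.
  have [a /eigenvalueP[u ua nzu]] := fixed_eigenvalue rGp.
  pose m := rVabelem abelM ntM u; exists (a : nat).
  have mg : m ^ g = m ^+ a by rewrite -(rVabelemJ abelM ntM nMG) // -/rG ua rVabelemZ.
  pose W := [set x in M | x ^ g == x ^+ a].
  have gW : group_set W.
    apply/group_setP; split=> [|x y]; first by rewrite inE group1 conj1g expg1n eqxx.
    rewrite !inE => /andP[Mx /eqP xg] /andP[My /eqP yg].
    by rewrite groupM //= conjMg xg yg expgMn //; apply: (centsP abM).
  have eW : group gW = M :> {set gT}.
    have /mingroupP[_ /(_ (group gW))] := minM; apply; last first.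
      by apply/subsetP=> x /setIdP[].
    apply/andP; split.
      apply/trivgPn; exists m; first by rewrite inE mem_rVabelem mg eqxx.
      by apply: contraNneq nzu => m1; rewrite -(rVabelemK abelM ntM u) -/m m1 morph1.
    apply/subsetP=> h Gh; rewrite inE; apply/subsetP=> _ /imsetP[x /setIdP[Mx /eqP xg] ->].
    have Mxh: x ^ h \in M by rewrite memJ_norm // (subsetP nMG).
    rewrite inE Mxh /= -conjXg -xg -!conjgM commgC conjgM.
    apply/eqP/conjg_fixP/commgP/commute_sym.
    apply: (centP (subsetP cD _ (mem_res1_comm p Gh Gg))).
    by rewrite memJ_norm ?(subsetP nMG) ?groupM.
  by move=> x; rewrite -{1}eW => /setIdP[_ /eqP].
have [m Mm ntm] := trivgPn _ ntM.
have eM: <[m]> = M.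
  have /mingroupP[_ /(_ <[m]>%G)] := minM; apply; last by rewrite cycle_subG.
  rewrite cycle_eq1 ntm; apply/subsetP=> g Gg; have [k mk] := power g Gg.
  by rewrite inE -cycleJ cycle_subG mk ?mem_cycle.
by rewrite -eM -orderE (abelem_order_p abelM).
Qed.

End MinNormalPgroup.

Lemma minnormal_prime_of_central (gT : finGroupType) (G M : {group gT}) :
  minnormal M G -> G \subset 'C(M) -> prime #|M|.
Proof.
move=> /mingroupP[/andP[ntM nMG] minM] cMG.
have [q_pr /(Cauchy q_pr)[x Mx ox]] : prime (pdiv #|M|) /\ pdiv #|M| %| #|M|.
  by rewrite pdiv_dvd pdiv_prime // cardG_gt1.
rewrite -(minM <[x]>%G) -?orderE ?ox ?cycle_subG //.
rewrite cycle_eq1 -order_eq1 ox neq_ltn prime_gt1 ?orbT //.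
rewrite centsC in cMG.
by rewrite cents_norm // cent_cycle sub_cent1 (subsetP cMG).
Qed.

Lemma p'elt_quotient_lift (gT : finGroupType) (pi : nat_pred) (A V : {group gT}) y :
  A \subset 'N(V) -> y \in A / V -> pi.-elt y ->
  exists2 x, x \in A /\ pi.-elt x & y = coset V x.
Proof.
move=> nVA /morphimP[x nVx Ax ->] piy; exists x.`_pi.
  by rewrite groupX // p_elt_constt.
by rewrite morph_constt ?constt_p_elt.
Qed.

Lemma res1_quotient (gT : finGroupType) (p : nat) (G V : {group gT}) :
  G \subset 'N(V) -> res1 p (G / V) \subset res1 p G / V.
Proof.
move=> nVG; rewrite join_subG /=; apply/andP; split.
  by rewrite -quotient_der // quotientS // joing_subl.
rewrite gen_subG; apply/subsetP=> _ /imsetP[_ /morphimP[x nVx Gx ->] ->].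
by rewrite -morphX // mem_quotient ?mem_res1_exp.
Qed.

(** Either [U :&: D] lies in [V], and [U / V] is central because [D] contains the derived subgroup,
    or [U :&: D] covers [U / V], which is then a [p]-group centralised by [D]. *)
Lemma chief_factor_prime (gT : finGroupType) (p : nat) (G E V U : {group gT}) :
  prime p -> E <| G -> p.-group (E :&: res1 p G) ->
  (forall a, a \in res1 p G -> p^'.-elt a -> a \in 'C(E :&: res1 p G)) ->
  chief_factor G V U -> U \subset E -> prime #|U / V|.
Proof.
set D := res1 p G => p_pr nsEG pY cY ch sUE.
have [nsVG nsUG ltVU maxV] := chief_factorP ch; have sVU := proper_sub ltVU.
have [sUG nUG] := andP nsUG; have nVG := normal_norm nsVG.
have nVU := subset_trans sUG nVG.
have nsDG: D <| G := res1_normal p G; have sDG := normal_sub nsDG.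
have minUV := chief_factor_minnormal ch.
have [sUDV | nUDV] := boolP (U :&: D \subset V).
  apply: minnormal_prime_of_central minUV _.
  rewrite centsC quotient_cents2 //; apply: subset_trans sUDV.
  rewrite subsetI commg_subl nUG; apply: subset_trans (joing_subl _ _).
  exact: commSg.
have eU: (U :&: D) <*> V = U.
  have sYU: (U :&: D) <*> V \subset U by rewrite join_subG subsetIl.
  apply/eqP/contraT=> neYU; case/negP: nUDV.
  rewrite -(maxV ((U :&: D) <*> V)%G) ?joing_subl ?joing_subr //.
    by rewrite normalY // normalI.
  by rewrite properEneq neYU.
have eUV: U / V = (U :&: D) / V.
  by rewrite -{1}eU quotientYidr // subIset ?nVU.
have pU: p.-group (U / V).
  by rewrite eUV quotient_pgroup // (pgroupS _ pY) // setSI.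
suff cD: D / V \subset 'C(U / V).
  rewrite (minnormal_prime_of_res1 p_pr _ pU minUV) ?quotientS //.
  exact: subset_trans (res1_quotient p nVG) cD.
apply: (minnormal_cent_of_p'elt _ pU minUV); first exact: quotientS.
  exact: quotient_normal.
move=> y /(p'elt_quotient_lift (subset_trans sDG nVG)) Dy p'y.
have [a [Da p'a] ->] := Dy _ p'y.
have: <[a]> / V \subset 'C((U :&: D) / V).
  rewrite quotient_cents // centsC; apply: subset_trans (setSI _ sUE) _.
  by rewrite centsC cycle_subG cY.
by rewrite -eUV => /subsetP; apply; rewrite mem_quotient ?cycle_id.
Qed.

Lemma pgroup_pquasinilpotent (gT : finGroupType) (p : nat) (Y : {group gT}) :
  p.-group Y -> pquasinilpotent p Y.
Proof.
move=> pY; apply/pquasinilpotentP=> U V ch _.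
have [nsVY nsUY ltVU _] := chief_factorP ch; have [sUY nUY] := andP nsUY.
have nVY := normal_norm nsVY; have nVU := subset_trans sUY nVY.
have /mingroupP[/andP[ntUV nUV] minUV] := chief_factor_minnormal ch.
have eZ: U / V :&: 'Z(Y / V) = U / V.
  apply: minUV; last exact: subsetIl.
  rewrite meet_center_nil ?quotient_normal //=; last exact: pgroup_nil (quotient_pgroup V pY).
  by rewrite normsI // gFnorm_trans ?normG.
have sUYV: [~: U, Y] \subset V.
  rewrite -quotient_cents2 // -eZ; apply: subset_trans (subsetIr _ _) _.
  exact: subsetIr.
apply/induces_innerP=> // a Ya; exists 1 => // y Uy.
by rewrite invg1 mulg1 (subsetP sUYV) // mem_commg.
Qed.

Lemma chief_factor_prime_of_small (gT : finGroupType) (p : nat)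
    (G E : {group gT}) (b4 : pred gT) (V U : {group gT}) :
  prime p -> E <| G ->
  (forall R : {group gT}, p^'.-group R -> R <| G -> R \subset E -> R :=: 1) ->
  (forall Q : {group gT}, p.-group Q -> Q \subset gen_pFitting p E ->
     {in Q, forall x, b4 x} \/ quaternion_free Q) ->
  (forall x, x \in gen_pFitting p E -> p.-elt x ->
     (#[x] == p) || (b4 x && (#[x] == 4)) -> partial_Pi_max p G <[x]>) ->
  chief_factor G V U -> U \subset E -> prime #|U / V|.
Proof.
set X := gen_pFitting p E => p_pr nsEG no_p' qfX PiX.
have nsXG: X <| G := gen_pFitting_normal p_pr nsEG.
have sXE: X \subset E := gen_pFitting_sub p E.
have sEG := normal_sub nsEG.
have pX: p.-group X.
  apply: (pgroup_of_small nsXG qfX PiX) => [W pW nsWG sWX a Xa p'a | R p'R nsRG sRX].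
    apply: (gen_pFitting_cent_pgroup _ pW Xa p'a).
    exact: normalS (subset_trans sWX sXE) sEG nsWG.
  exact: no_p' (subset_trans sRX sXE).
have cX := cent_res1_of_small p_pr nsXG qfX PiX pX.
have pY: p.-group (E :&: res1 p G).
  apply: (@pgroup_of_p'elt_eq1 _ p (E :&: res1 p G)%G) => a /setIP[Ea Da] p'a.
  have Xa: a \in X.
    by apply: (subsetP (cent_gen_pFitting p_pr E)); rewrite inE Ea cX.
  by apply/eqP; rewrite -order_eq1 (pnat_1 (mem_p_elt pX Xa) p'a).
have sYX: E :&: res1 p G \subset X.
  apply: pquasinilpotent_sub_gen_pFitting (pgroup_pquasinilpotent pY).
  exact: normalS (subsetIl _ _) sEG (normalI nsEG (res1_normal p G)).
apply: chief_factor_prime p_pr nsEG pY _ => a Da p'a.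
exact: subsetP (centS sYX) a (cX a Da p'a).
Qed.

Lemma gen_pFitting_quotient (gT : finGroupType) (p : nat) (E N : {group gT}) :
  prime p -> N <| E -> p^'.-group N ->
  gen_pFitting p (E / N) \subset gen_pFitting p E / N.
Proof.
move=> p_pr nsNE p'N; rewrite gen_subG; apply/bigcupsP=> Mb /andP[nsMb].
have [M /group_inj-> sNM nsME] := inv_quotientN nsNE nsMb => qMb.
apply/quotientS/pquasinilpotent_sub_gen_pFitting; first exact: nsME.
have nNM: M \subset 'N(N) := subset_trans (normal_sub nsME) (normal_norm nsNE).
apply: (@pquasinilpotent_of_morphim _ _ _ M (restrm_morphism nNM (coset_morphism N))) => //.
  by rewrite ker_restrm ker_coset (pgroupS (subsetIr _ _)).
suff -> : (restrm_morphism nNM (coset_morphism N) @* M)%G = (M / N)%G by [].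
by apply/val_inj; rewrite /= morphim_restrm setIid.
Qed.

Lemma partial_Pi_max_quotient (gT : finGroupType) (p : nat) (G N H : {group gT}) :
  N <| G -> p^'.-group N -> p.-group H -> H \subset G ->
  partial_Pi G H -> partial_Pi_max p (G / N) (H / N).
Proof.
move=> nsNG p'N pH sHG piH Vb Rb nsVb nsRb; have [sNG nNG] := andP nsNG.
have nNH := subset_trans sHG nNG.
have [V -> sNV nsVG] := inv_quotientN nsNG nsVb.
have [R -> sNR nsRG] := inv_quotientN nsNG nsRb.
have nsNV : N <| V := normalS sNV (normal_sub nsVG) nsNG.
have nsNR : N <| R := normalS sNR (normal_sub nsRG) nsNG.
rewrite quotient_proper // => ltVR maxV.
rewrite quotientSGK // => sHR _.
have pi: p.-nat #|G : 'N_G(H <*> V)|.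
  apply: (partial_Pi_index nsNG p'N pH sHR piH nsVG nsRG sNV ltVR).
  move=> K nsKG sNK ltKR.
  have nsNK : N <| K := normalS sNK (normal_sub nsKG) nsNG.
  have := maxV (K / N)%G (quotient_normal N nsKG).
  rewrite quotient_proper // => /(_ ltKR).
  by rewrite quotientSGK // (subset_trans (normal_sub nsKG)).
rewrite -quotientY ?(subset_trans (normal_sub nsVG)) //.
have sNV' : N \subset 'N_G(H <*> V).
  rewrite subsetI sNG; apply: subset_trans sNV _.
  exact: subset_trans (joing_subr _ _) (normG _).
rewrite -(index_quotient_eq (subset_trans (subsetIr G N) sNV') (subsetIl _ _) nNG) in pi.
apply: (pnat_dvd _ pi); apply: indexgS.
by rewrite subsetI quotientS ?subsetIl // quotient_norms ?subsetIr //.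
Qed.

(** * Formations and extensions by normal subgroups of prime order *)

Section Formations.

Variable F : group_class.
Hypothesis formF : formation F.

Lemma formation_isog (aT bT : finGroupType) (A : {group aT}) (B : {group bT}) :
  A \isog B -> F A -> F B.
Proof.
case/isogP=> f _ fA FA; have [/(_ aT bT A f FA)] := formF.
by rewrite (_ : (f @* A)%G = B) //; apply: group_inj.
Qed.

Lemma formation_quotient (gT : finGroupType) (G N : {group gT}) :
  G \subset 'N(N) -> F G -> F (G / N)%G.
Proof.
move=> nNG FG; have [/(_ _ _ G (restrm_morphism nNG (coset_morphism N)) FG)] := formF.
rewrite (_ : (_ @* G)%G = (G / N)%G) //.
by apply: group_inj; rewrite /= morphim_restrm setIid.
Qed.

Lemma formation_quotientS (gT : finGroupType) (G M N : {group gT}) :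
  M <| G -> N <| G -> M \subset N -> F (G / M)%G -> F (G / N)%G.
Proof.
move=> nsMG nsNG sMN FM; have := third_isog sMN nsMG nsNG.
move/formation_isog; apply; apply: formation_quotient FM.
by rewrite quotient_norms ?normal_norm.
Qed.

Lemma formation_subdirect (gT : finGroupType) (G M N : {group gT}) :
  M <| G -> N <| G -> F (G / M)%G -> F (G / N)%G -> F (G / (M :&: N))%G.
Proof.
move=> nsMG nsNG FM FN; have nMG := normal_norm nsMG; have nNG := normal_norm nsNG.
pose h x := (coset M x, coset N x).
have hM : {in G &, {morph h : x y / x * y}}.
  by move=> x y Gx Gy; rewrite /h !morphM ?(subsetP nMG) ?(subsetP nNG).
pose f := Morphism hM.
have kerf: 'ker f = M :&: N.
  apply/setP=> x; rewrite !inE; apply/andP/andP=> [[Gx /eqP[/coset_idr Mx /coset_idr Nx]] | [Mx Nx]].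
    by rewrite Mx ?Nx ?(subsetP nMG) ?(subsetP nNG).
  by rewrite (subsetP (normal_sub nsMG)) //= /h !coset_id.
have := first_isog f; rewrite kerf isog_sym => /formation_isog.
have [_ /(_ _ _ (G / M)%G (G / N)%G (f @* G)%G)] := formF.
have im1 : [set x.1 | x in (f @* G)%G] = (G / M)%G.
  apply/setP=> x; apply/imsetP/morphimP=> [[_ /morphimP[y _ Gy ->] ->] | [y _ Gy ->]].
    by exists y; rewrite ?(subsetP nMG).
  by exists (f y); rewrite ?mem_morphim.
have im2 : [set x.2 | x in (f @* G)%G] = (G / N)%G.
  apply/setP=> x; apply/imsetP/morphimP=> [[_ /morphimP[y _ Gy ->] ->] | [y _ Gy ->]].
    by exists y; rewrite ?(subsetP nNG).
  by exists (f y); rewrite ?mem_morphim.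
move=> /(_ im1 im2 FM FN) Ff; apply; exact: Ff.
Qed.

End Formations.

(* [L] and the Frattini subgroup of [C] are normal in [H], and [same_power] makes
   them isomorphic as [G]-groups, so their diagonal [Dg] is normal as well. In
   [H / Dg] the image of [L] lies in the Frattini subgroup of the image of [C],
   which is where saturation applies; [H] is then recovered from [H / L] and
   [H / Dg]. *)
Section CyclicExtension.

Variables (F : group_class) (hT : finGroupType) (q : nat).
Variables (H C G : {group hT}) (c y : hT).

Hypotheses (formF : formation F) (satF : solubly_saturated F).
Hypothesis (supF : subclass supersolvable F).
Hypotheses (q_pr : prime q) (defH : C ><| G = H).
Hypotheses (defC : C :=: <[c]>) (oc : #[c] = (q ^ 2)%N).
Hypotheses (Gy : y \in G) (oy : #[y] = q).
Hypothesis same_power : forall g, g \in G ->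
  exists k, y ^ g = y ^+ k /\ (c ^+ q) ^ g = (c ^+ q) ^+ k.
Hypothesis cent_yC : 'C_G[y] \subset 'C(C).

Let L := <[y]>%G.
Let z := c ^+ q.
Let K := 'C_G[y]%G.

Let sdp : [/\ C <| H, G \subset H, C * G = H & C :&: G = 1].
Proof. by have [? ? ? _ ?] := sdprod_context defH. Qed.

Let nsCH : C <| H. Proof. by case: sdp. Qed.
Let sGH : G \subset H. Proof. by case: sdp. Qed.
Let mulCG : C * G = H. Proof. by case: sdp. Qed.
Let tiCG : C :&: G = 1. Proof. by case: sdp. Qed.
Let nCG : G \subset 'N(C) := subset_trans sGH (normal_norm nsCH).
Let joinCG : C <*> G = H. Proof. by rewrite norm_joinEr. Qed.

Let Cc : c \in C. Proof. by rewrite defC cycle_id. Qed.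
Let Cz : z \in C. Proof. exact: groupX. Qed.
Let abC : abelian C. Proof. by rewrite defC cycle_abelian. Qed.
Let sLG : L \subset G. Proof. by rewrite cycle_subG. Qed.
Let sLK : L \subset K. Proof. by rewrite cycle_subG inE Gy cent1id. Qed.

Let nLG : G \subset 'N(L).
Proof.
apply/subsetP=> g Gg; rewrite inE -cycleJ cycle_subG.
by have [k [-> _]] := same_power Gg; rewrite mem_cycle.
Qed.

Let nsLG : L <| G. Proof. by rewrite /normal sLG. Qed.

Let nsKG : K <| G.
Proof. by rewrite /normal subsetIl /= -cent_cycle normsI ?normG ?norms_cent. Qed.

Let cCK : C \subset 'C(K). Proof. by rewrite centsC. Qed.
Let cCL : C \subset 'C(L). Proof. exact: subset_trans cCK (centS sLK). Qed.

Let normalH (J : {group hT}) : J \subset H -> C \subset 'N(J) ->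
  G \subset 'N(J) -> J <| H.
Proof. by move=> sJH nJC nJG; rewrite /normal sJH -mulCG mulG_subG nJC. Qed.

Let normalGH (J : {group hT}) : J <| G -> C \subset 'C(J) -> J <| H.
Proof.
case/andP=> sJG nJG cCJ.
by apply: normalH (subset_trans sJG sGH) _ nJG; apply: cents_norm.
Qed.

Let nsLH : L <| H. Proof. exact: normalGH. Qed.
Let nsKH : K <| H. Proof. exact: normalGH. Qed.

Let isogGH (J : {group hT}) : J <| G -> C \subset 'C(J) ->
  G / J \isog H / (C <*> J).
Proof.
move=> nsJG cCJ; have [sJG nJG] := andP nsJG.
have nCJG: G \subset 'N(C <*> J) by rewrite normsY.
have := second_isog nCJG.
have -> : (C <*> J) :&: G = J.
  rewrite norm_joinEr ?(subset_trans sJG) // setIC -group_modr //.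
  by rewrite setIC tiCG mul1g.
suff -> : H / (C <*> J) = G / (C <*> J) by [].
have <- : C <*> J <*> G = H by rewrite -joingA (joing_idPr sJG).
by rewrite quotientYidl.
Qed.

Let zq : z ^+ q = 1.
Proof. by rewrite -expgM mulnn -oc expg_order. Qed.
Let yq : y ^+ q = 1. Proof. by rewrite -oy expg_order. Qed.
Let oz : #[z] = q.
Proof.
by rewrite orderXdiv oc -mulnn ?mulnK ?prime_gt0 ?dvdn_mulr.
Qed.
Let commyz : commute y z.
Proof. by apply/commute_sym; apply: (centsP cCL); rewrite ?cycle_id. Qed.

Let Dg := <[y * z]>%G.

Let nsDH : Dg <| H.
Proof.
apply: normalH.
- rewrite cycle_subG; apply: groupM; first exact: (subsetP sGH).
  exact: (subsetP (normal_sub nsCH)).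
- rewrite cents_norm // cent_cycle sub_cent1 groupM //.
    by apply: (subsetP cent_yC); rewrite inE Gy cent1id.
  exact: (subsetP abC).
apply/subsetP=> g Gg; rewrite inE -cycleJ cycle_subG conjMg.
have [k [-> ->]] := same_power Gg.
by rewrite -expgMn ?mem_cycle.
Qed.

Let tiLC : L :&: C = 1.
Proof. by apply/trivgP; rewrite /= -tiCG [C :&: G]setIC setSI. Qed.

Let tiLD : L :&: Dg = 1.
Proof.
apply/trivgP/subsetP=> x /setIP[Lx /cycleP[i ex]]; rewrite inE.
move: Lx; rewrite ex expgMn // groupMl ?mem_cycle // => Lzi.
have: z ^+ i \in L :&: C by rewrite inE Lzi groupX.
rewrite tiLC => /set1P zi1.
have: q %| i by rewrite -oz order_dvdn zi1.
by case/dvdnP=> k ->; rewrite !(mulnC k) !expgM zq yq !expg1n mulg1.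
Qed.

Let cyclicGK : cyclic (G / K).
Proof.
have eK : K = 'ker_G (conj_aut L) :> {set hT}.
  by rewrite ker_conj_aut cent_cycle.
rewrite eK (isog_cyclic (first_isog_loc _ nLG)).
apply: cyclicS (Aut_conj_aut _ _) _.
by apply: Aut_prime_cyclic; rewrite -orderE oy.
Qed.

(** [H / K] is supersolvable: [C] gives a cyclic normal subgroup, and above it [G / K] is cyclic, as
    it embeds in the automorphism group of [L]. *)
Let F_mod_K : F (H / K)%G.
Proof.
have nKH := normal_norm nsKH.
apply: supF; exists [:: ((C <*> K) / K)%G; (H / K)%G] => //=.
have nsCK : C <*> K <| H by rewrite normalY.
rewrite sub1G quotient_normal // quotientS ?normal_sub // normal_refl /= !andbT.
apply/andP; split.
  rewrite -(isog_cyclic (quotient1_isog _)) /= quotientYidr.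
    by rewrite quotient_cyclic // defC cycle_cyclic.
  by rewrite cents_norm.
rewrite (isog_cyclic (third_isog (joing_subr C K) nsKH nsCK)).
by rewrite -(isog_cyclic (isogGH nsKG cCK)).
Qed.

(** [L] is the intersection of [C <*> L] and [K], and the quotient by the former is a copy of
    [G / L]. *)
Let F_mod_L : F (G / L)%G -> F (H / L)%G.
Proof.
move=> FGL; have nsCL : C <*> L <| H by rewrite normalY.
have := formation_subdirect formF nsCL nsKH _ F_mod_K.
have eI : (C <*> L) :&: K = L.
  rewrite norm_joinEr ?(subset_trans sLG) // setIC.
  have tiKC: K :&: C = 1 by apply/trivgP; rewrite /= -tiCG [C :&: G]setIC setSI ?subsetIl.
  by rewrite -group_modr // tiKC mul1g.
rewrite eI; apply; apply: (formation_isog formF _ FGL).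
exact: isogGH.
Qed.

Let Phi_C : 'Phi(C) = <[z]>.
Proof.
have qC : q.-group C by rewrite /pgroup defC -orderE oc pnatX pnat_id.
rewrite (Phi_Mho qC abC) defC (@Mho_p_cycle 1 _ q) ?expn1 //.
by rewrite /p_elt oc pnatX pnat_id.
Qed.

(** Modulo [Dg] the generators [z] and [y^-1] coincide, so dividing out the Frattini subgroup of
    [C / Dg] also kills [L] and leaves a quotient of [H / L]. *)
Let F_mod_D : F (H / L)%G -> F (H / Dg)%G.
Proof.
move=> FHL; have qC : q.-group C by rewrite /pgroup defC -orderE oc pnatX pnat_id.
have nDC : C \subset 'N(Dg) := subset_trans (normal_sub nsCH) (normal_norm nsDH).
have nszH : <[z]> <| H.
  by rewrite -Phi_C gFnormal_trans.
have nszD : (<[z]> <*> Dg)%G <| H by rewrite normalY.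
apply: (satF (N := (C / Dg)%G)); first exact: quotient_normal.
  by rewrite quotient_sol // abelian_sol.
have ePhi : 'Phi(C / Dg) = (<[z]> <*> Dg) / Dg.
  rewrite -(quotient_Phi qC nDC) Phi_C quotientYidr //.
  by rewrite cycle_subG (subsetP nDC).
have ePhiG : 'Phi(C / Dg)%G = ((<[z]> <*> Dg) / Dg)%G by apply: group_inj.
have := third_isog (joing_subr <[z]> Dg) nsDH nszD.
rewrite isog_sym => iso3.
have FzD : F (H / (<[z]> <*> Dg))%G.
  apply: (formation_quotientS formF nsLH nszD) FHL.
  rewrite cycle_subG -(mulgK z y) groupM ?groupV //=.
    by rewrite (subsetP (joing_subr _ _)) ?cycle_id.
  by rewrite (subsetP (joing_subl _ _)) ?cycle_id.
have := formation_isog formF iso3 FzD; rewrite /=.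
by rewrite -!/(gval _) -ePhi.
Qed.

Lemma formation_cyclic_extension : F (G / L)%G -> F G.
Proof.
move=> FGL; have FHL := F_mod_L FGL; have FHD := F_mod_D FHL.
have := formation_subdirect formF nsLH nsDH FHL FHD.
rewrite /= tiLD.
have iso1 : H / 1 \isog H by rewrite isog_sym quotient1_isog.
move/(formation_isog formF iso1) => FH.
have := formation_quotient formF (normal_norm nsCH) FH.
apply: (formation_isog formF); rewrite isog_sym.
have := isogGH (normal1 G) (cents1 C); rewrite joingG1 => iso2.
exact: isog_trans (quotient1_isog G) iso2.
Qed.

End CyclicExtension.

Lemma isog_quotient_injm (aT rT : finGroupType) (D G L : {group aT})
    (f : {morphism D >-> rT}) :
  'injm f -> G \subset D -> L <| G -> G / L \isog (f @* G) / (f @* L).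
Proof.
move=> injf sGD nsLG; have [sLG nLG] := andP nsLG.
have sLD := subset_trans sLG sGD.
pose h := comp_morphism f (coset_morphism (f @* L)).
have sGh: G \subset f @*^-1 'N(f @* L).
  by rewrite -sub_morphim_pre // morphim_norms.
have := first_isog_loc h sGh; rewrite morphim_comp.
suff -> : 'ker_G h = L by [].
rewrite ker_comp ker_coset morphimGK ?(setIidPr sLG) //.
by apply: subset_trans injf _; apply: sub1G.
Qed.

(** In [a ^ q - b ^ q = (a - b) * S] the sum [S] has [q] terms, all congruent to [b ^ q.-1] modulo
    [q], so both factors are divisible by [q]. *)
Lemma expn_mod_sqr (q a b : nat) :
  a = b %[mod q] -> a ^ q = b ^ q %[mod q ^ 2].
Proof.
wlog le_ba: a b / b <= a => [IH | eab].
  by case/orP: (leq_total b a) => le /esym eab; [|symmetry]; apply: IH.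
apply/eqP; rewrite eqn_mod_dvd; last first.
  by case: q {eab} => // q; rewrite leq_exp2r.
rewrite subn_exp -mulnn dvdn_mul //; first by rewrite -eqn_mod_dvd // eab.
have modi (i : 'I_q) : a ^ (q.-1 - i) * b ^ i = b ^ q.-1 %[mod q].
  rewrite -modnMml -modnXm eab modnXm modnMml -expnD subnK //.
  by rewrite -ltnS prednK // (leq_ltn_trans _ (ltn_ord i)).
rewrite /dvdn -modn_summ (eq_bigr (fun=> b ^ q.-1 %% q)) => [|i _].
  by rewrite modn_summ sum_nat_const card_ord modnMr.
by rewrite modi.
Qed.

Lemma formation_prime_extension (F : group_class) (gT : finGroupType)
    (G L : {group gT}) :
  formation F -> solubly_saturated F -> subclass supersolvable F ->
  L <| G -> prime #|L| -> F (coset_of L) (G / L)%G -> F gT G.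
Proof.
move=> formF satF supF nsLG q_pr FGL; set q := #|L| in q_pr.
have [sLG nLG] := andP nsLG.
have [y defL] := cyclicP (prime_cyclic q_pr).
have oy : #[y] = q by rewrite orderE -defL.
have Ly : y \in L by rewrite defL cycle_id.
have Gy := subsetP sLG y Ly.
have q_gt0 := prime_gt0 q_pr; have q_gt1 := prime_gt1 q_pr.
(* [u g] is an exponent by which [g] acts on [L]; the default is never reached for [g] in [G]. *)
pose u g := odflt ord0 [pick k : 'I_q.+1 | y ^ g == y ^+ k] : nat.
have yu g : g \in G -> y ^ g = y ^+ u g.
  move=> Gg; rewrite /u; case: pickP => [k /eqP // | no_k].
  have: y ^ g \in <[y]> by rewrite -defL memJ_norm // (subsetP nLG).
  case/cyclePmin=> k; rewrite oy => ltk ek.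
  by have := no_k (inord k); rewrite inordK ?ek ?eqxx // ltnS ltnW.
have uM g h : g \in G -> h \in G -> u (g * h) = u g * u h %[mod q].
  move=> Gg Gh; apply/eqP; rewrite -oy -eq_expg_mod_order -yu ?groupM //.
  by rewrite conjgM yu // conjXg yu // -expgM mulnC.
have u_co g : g \in G -> coprime q (u g).
  move=> Gg; rewrite prime_coprime // -{1}oy order_dvdn -yu //.
  by rewrite conjg_eq1 -order_eq1 oy neq_ltn q_gt1 orbT.
pose cT := 'Z_(q ^ 2); pose R := [set: cT]%G; pose c : cT := Zp1.
have q2_gt1: 1 < q ^ 2 by rewrite (ltn_exp2l 0).
have oc : #[c] = (q ^ 2)%N by rewrite order_Zp1 Zp_cast.
have oR : #|R| = (q ^ 2)%N by rewrite cardsT card_ord Zp_cast.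
have defR : R = <[c]>%G.
  by apply/eqP; rewrite eq_sym -val_eqE /= eqEcard subsetT /= [#|[set: _]|]oR -orderE oc.
have modR (x : cT) a b : a = b %[mod q ^ 2] -> x ^+ a = x ^+ b.
  move=> eab; have x1 : x ^+ (q ^ 2) = 1.
    by apply/eqP; rewrite -order_dvdn -[X in _ %| X]oR order_dvdG ?inE.
  by rewrite -(expg_mod a x1) eab expg_mod.
(* [u g] only matters modulo [q], so its [q]-th power is well defined modulo
   [q ^ 2]; this lifts the action of [G] on [L] to a cyclic group of order
   [q ^ 2]. *)
pose U g := (u g ^ q)%N.
have UM g h : g \in G -> h \in G -> U (g * h) = U g * U h %[mod q ^ 2].
  by move=> Gg Gh; rewrite /U -expnMn; apply: expn_mod_sqr; apply: uM.
pose to (x : cT) g := if g \in G then x ^+ U g else x.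
have to_act : is_action G to.
  split=> [g x1 x2 | x g h Gg Gh].
    rewrite /to; case: ifP => // Gg e.
    have co : coprime #|R| (U g) by rewrite oR coprimeXl // coprimeXr // u_co.
    by apply: (can_in_inj (expgK co)) e; rewrite inE.
  by rewrite /to groupM // Gg Gh -expgM; apply: modR; apply: UM.
pose to1 := Action to_act.
have to_gact : is_groupAction R to1.
  move=> g Gg; rewrite inE; apply/andP; split; first by apply/subsetP=> x; rewrite inE.
  apply/morphicP=> x1 x2 _ _; rewrite !actpermE /= /to Gg.
  by rewrite expgMn //; apply: (centsP (Zp_abelian _)); rewrite ?inE.
pose toG := GroupAction to_gact.
pose f1 := sdpair1 toG; pose f2 := sdpair2 toG.
have inj1 : 'injm f1 := injm_sdpair1 toG.
have inj2 : 'injm f2 := injm_sdpair2 toG.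
have Rx x : x \in R by rewrite inE.
have actE x g : g \in G -> f1 x ^ f2 g = f1 (x ^+ U g).
  by move=> Gg; rewrite -sdpair_act //= /to Gg.
suff FG1 : F _ (f2 @* G)%G.
  by apply: (formation_isog formF _ FG1); rewrite isog_sym sub_isog.
apply: (@formation_cyclic_extension F _ q setT%G (f1 @* R)%G (f2 @* G)%G (f1 c) (f2 y)) => //.
- exact: sdprod_sdpair.
- rewrite -morphim_cycle //; congr (f1 @* _); exact: congr_group defR.
- by rewrite order_injm.
- exact: mem_morphim.
- by rewrite order_injm.
- move=> _ /morphimP[g _ Gg ->]; exists (u g); split.
    by rewrite -morphJ // yu // morphX.
  (* On [c ^+ q] exponents count only modulo [q], where [U g] and [u g] agree by Fermat. *)
  rewrite -[f1 c ^+ q]morphX // actE // -morphX // -!expgM; congr (f1 _).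
  by apply: modR; rewrite -mulnn -!muln_modr; congr (_ * _)%N; apply: fermat_little.
- apply/subsetP=> _ /setIP[/morphimP[g _ Gg ->] /cent1P cyg].
  have yg : y ^ g = y.
    apply: (injmP inj2); rewrite ?groupJ // morphJ //.
    by apply/conjg_fixP/commgP/commute_sym.
  have U1 : U g = 1 %[mod q ^ 2].
    have := @expn_mod_sqr q (u g) 1; rewrite exp1n; apply; apply/eqP.
    by rewrite -oy -eq_expg_mod_order -yu // yg expg1.
  apply/centP=> _ /morphimP[x _ _ ->]; apply/commute_sym/commgP/conjg_fixP.
  by rewrite actE // (modR _ _ _ U1) expg1.
rewrite /= -(morphim_cycle _ Gy) -defL.
by apply: (formation_isog formF _ FGL); apply: isog_quotient_injm.
Qed.

(** The induction descends from [E] to 1: if [U] is minimal normal above [K], then [G / K] has the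
    normal subgroup [U / K] of prime order, with quotient [G / U]. *)
Lemma formation_of_chief_primes (F : group_class) (gT : finGroupType)
    (G E : {group gT}) :
  formation F -> solubly_saturated F -> subclass supersolvable F -> E <| G ->
  (forall V U : {group gT}, chief_factor G V U -> U \subset E -> prime #|U / V|) ->
  F (coset_of E) (G / E)%G -> F gT G.
Proof.
move=> formF satF supF nsEG primeE FGE.
suff FK (K : {group gT}) : K <| G -> K \subset E -> F _ (G / K)%G.
  apply: (formation_isog formF _ (FK 1%G (normal1 G) (sub1G E))).
  by rewrite isog_sym quotient1_isog.
have [m] := ubnP (#|E| - #|K|); elim: m K => // m IHm K le_m nsKG sKE.
have [eKE | neKE] := eqVneq K E; first by rewrite eKE.
have ltKE : K \proper E by rewrite properEneq neKE.
pose Q (U : {group gT}) := [&& K \proper U, U <| G & U \subset E].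
have [U /mingroupP[/and3P[ltKU nsUG sUE] minU]] : {U : {group gT} | mingroup U Q}.
  by apply: ex_mingroup; exists E; rewrite /Q ltKE nsEG /=.
have ch : chief_factor G K U.
  rewrite /chief_factor nsUG andbT; apply/maxgroupP.
  split=> [|H /andP[ltHU nHG] sKH]; first by rewrite ltKU normal_norm.
  apply/eqP/contraT; rewrite eq_sym => neKH; have sHU := proper_sub ltHU.
  have QH : Q H.
    rewrite /Q properEneq neKH sKH (subset_trans sHU sUE) andbT.
    by rewrite /normal nHG (subset_trans sHU) ?normal_sub.
  by have := proper_neq ltHU; rewrite (minU H QH sHU) eqxx.
have sKU := proper_sub ltKU.
apply: (@formation_prime_extension F _ (G / K)%G (U / K)%G) => //.
- exact: quotient_normal.
- exact: primeE.
apply: (formation_isog formF _ (IHm U _ nsUG sUE)).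
  by rewrite isog_sym third_isog.
apply: leq_trans (_ : #|E| - #|K| <= m) => //.
by rewrite ltn_sub2l ?proper_card // (leq_trans (proper_card ltKU)) // subset_leq_card.
Qed.

(** * Reduction modulo ['O_p^'(E)] and conclusion *)

Lemma Sylow_cover_quotient (gT : finGroupType) (p : nat) (X N : {group gT})
    (Q : {group coset_of N}) :
  X \subset 'N(N) -> p.-group Q -> Q \subset X / N ->
  exists2 P : {group gT}, p.-Sylow(X) P & Q \subset P / N.
Proof.
move=> nNX pQ sQX; have [P sylP] := Sylow_exists p X.
have nNP := subset_trans (pHall_sub sylP) nNX.
have [y Xy sQy] := Sylow_subJ (quotient_pHall nNP sylP) sQX pQ.
case/morphimP: Xy sQy => x nNx Xx -> sQ.
by exists (P :^ x)%G; [rewrite pHallJ | rewrite quotientJ].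
Qed.


Unset Implicit Arguments.

Theorem theoremB (p : nat) (gT : finGroupType) (G E : {group gT})
    (F : group_class)
    (p_prime : prime p)
    (F_formation : formation F)
    (F_solubly_saturated : solubly_saturated F)
    (F_supersolvable : subclass supersolvable F)
    (E_normal : E <| G)
    (F_quotient : F (coset_of E) (G / E)%G)
    (Pi_cyclic : forall P H : {group gT},
       p.-Sylow(gen_pFitting p E) P ->
       H \subset P -> cyclic H ->
       prime #|H| \/ (#|H| = 4 /\ ~~ quaternion_free P) ->
       partial_Pi G H) :
  p'_by p F G.
Proof.
pose N := 'O_p^'(E)%G; pose X := gen_pFitting p E.
have p'N : p^'.-group N := pcore_pgroup _ E.
have nsNE : N <| E := pcore_normal _ E.
have nsNG : N <| G := gFnormal_trans _ E_normal.
have sEG := normal_sub E_normal; have nNG := normal_norm nsNG.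
have nsXG : X <| G := gen_pFitting_normal p_prime E_normal.
have nNX : X \subset 'N(N) := subset_trans (normal_sub nsXG) nNG.
exists N; split=> //.
have sXX : gen_pFitting p (E / N) \subset X / N by apply: gen_pFitting_quotient.
have nsEb : (E / N)%G <| (G / N)%G by apply: quotient_normal.
pose b4 (x : coset_of N) :=
  [exists P : {group gT}, [&& p.-Sylow(X) P, ~~ quaternion_free P & x \in P / N]].
apply: (@formation_of_chief_primes F _ (G / N)%G (E / N)%G) => //; last first.
  apply: (formation_isog F_formation _ F_quotient); rewrite isog_sym.
  exact: third_isog (normal_sub nsNE) nsNG E_normal.
move=> V U; apply: (@chief_factor_prime_of_small _ p _ _ b4) => //.
- move=> R p'R nsRG sRE; apply/trivgP; rewrite -(trivg_pcore_quotient p^' E).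
  by apply: pcore_max => //; apply: normalS sRE (normal_sub nsEb) nsRG.
- move=> Q pQ sQX.
  have [P sylP sQP] := Sylow_cover_quotient nNX pQ (subset_trans sQX sXX).
  have [qfP | nqfP] := boolP (quaternion_free P); [right | left].
    apply: quaternion_freeS sQP _.
    exact: (quaternion_free_morphim (coset_morphism N)
      (subset_trans (pHall_sub sylP) nNX) qfP).
  by move=> x Qx; apply/existsP; exists P; rewrite sylP nqfP (subsetP sQP).
move=> x Xx px ox.
have [P [sylP Px oP]] : exists P : {group gT}, [/\ p.-Sylow(X) P, x \in P / N
    & prime #[x] \/ (#[x] = 4 /\ ~~ quaternion_free P)].
  case/orP: ox => [/eqP ox | /andP[/existsP[P /and3P[sylP nqfP Px]] /eqP ox]].
    have sxX : <[x]> \subset X / N by rewrite cycle_subG (subsetP sXX).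
    have [P sylP sxP] := Sylow_cover_quotient nNX px sxX.
    exists P; split=> //; first by rewrite -cycle_subG. 
    by left; rewrite ox.
  by exists P; split=> //; right.
have [sPX pP _] := and3P sylP; have nNP := subset_trans sPX nNX.
case/morphimP: Px => y nNy Py ex.
have syP : <[y]> \subset P by rewrite cycle_subG.
have exy : <[x]>%G = (<[y]> / N)%G.
  by apply: group_inj; rewrite /= quotient_cycle // ex.
(* The lift [y] lies in the [p]-group [P], which meets [N] trivially, so the order is preserved. *)
have oyx : #|<[y]>| = #[x].
  rewrite orderE (congr_group exy); apply/card_isog/quotient_isog.
    by rewrite cycle_subG.
  rewrite setIC; apply: coprime_TIg.
  exact: pnat_coprime (pgroupS syP pP) p'N.
rewrite exy; apply: partial_Pi_max_quotient => //.
- exact: pgroupS syP pP.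
- exact: subset_trans syP (subset_trans sPX (normal_sub nsXG)).
by apply: (Pi_cyclic P) => //; [apply: cycle_cyclic | rewrite oyx].
Qed.
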